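(* The problem of solving a system of equations over the group $\mathbb{Z} \wr \mathbb{Z}$ is undecidable. That is, there is no algorithm for the following problem with $G = \mathbb{Z} \wr \mathbb{Z}$. Input: a finite set of variables $\mathcal{X} = \{x_1, \ldots, x_n\}$ and finite words $w_1, \ldots, w_t$ over the alphabet $\mathcal{X} \cup \mathcal{X}^{-1} \cup G$. Question: do there exist $g_1, \ldots, g_n \in G$ such that $w_1(g_1, \ldots, g_n) = \cdots = w_t(g_1, \ldots, g_n) = e$?
   Context: $\mathbb{Z}[X^{\pm}] = \mathbb{Z}[X, X^{-1}]$ is the ring of Laurent polynomials with integer coefficients. The wreath product $\mathbb{Z} \wr \mathbb{Z}$ is the group $\mathbb{Z}[X^{\pm}] \rtimes \mathbb{Z}$ of pairs $(f, b)$ with $f \in \mathbb{Z}[X^{\pm}]$, $b \in \mathbb{Z}$, with multiplication $(f,b)\cdot(f',b') = (f + X^b f', b + b')$ and neutral element $e = (0,0)$. $\mathcal{X}^{-1} = \{x_1^{-1}, \ldots, x_n^{-1}\}$ is the alphabet of formal inverses. For a word $w$ over $\mathcal{X} \cup \mathcal{X}^{-1} \cup G$, $w(g_1, \ldots, g_n) \in G$ denotes the product in $G$ of the word obtained by substituting $g_i$ for $x_i$ and $g_i^{-1}$ for $x_i^{-1}$ for all $i$. *)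

(* Defs.v *)
From HB Require Import structures.
From mathcomp Require Import all_boot all_order all_algebra.
From mathcomp Require Import finmap.
From mathcomp.multinomials Require Import monalg.

Set Implicit Arguments.
Unset Strict Implicit.
Unset Printing Implicit Defensive.

Import Order.TTheory GRing.Theory Num.Theory.

Local Open Scope ring_scope.

(* The library makes {malg R[K]} a ring only when the monoid K has no
   nontrivial units, which excludes K = int: only the additive group is reused
   here, f@_k being the coefficient of X^k, and the product is added. *)
Definition laurent : Type := {malg int[int]}.

HB.instance Definition _ := GRing.Zmodule.copy laurent {malg int[int]}.

Definition laurentX (b : int) : laurent := << b >>.

(* Locked so that conversion never unfolds products. *)
HB.lock Definition laurent_mul (f g : laurent) : laurent :=
  \sum_(i <- msupp f) \sum_(j <- msupp g) << f@_i * g@_j *g i + j >>.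

Section LaurentRing.

Implicit Types f g h : laurent.

Lemma laurent_mulE (d1 d2 : {fset int}) f g :
    (msupp f `<=` d1)%fset -> (msupp g `<=` d2)%fset ->
  laurent_mul f g = \sum_(i <- d1) \sum_(j <- d2) << f@_i * g@_j *g i + j >>.
Proof.
move=> le1 le2; rewrite laurent_mul.unlock (big_fset_incl _ le1) /=.
  apply/eq_bigr=> i _; apply/big_fset_incl => // j _ /mcoeff_outdom ->.
  by rewrite mulr0 monalgU0.
by move=> i _ /mcoeff_outdom fi; rewrite big1 // => j _; rewrite fi mul0r monalgU0.
Qed.

Lemma laurent_mulC : commutative laurent_mul.
Proof.
move=> f g; rewrite laurent_mul.unlock exchange_big; apply/eq_bigr=> i _.
by apply/eq_bigr=> j _; rewrite mulrC addrC.
Qed.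

Lemma laurent_mulUU (c d : int) (i j : int) :
  laurent_mul << c *g i >> << d *g j >> = << c * d *g i + j >>.
Proof.
by rewrite (laurent_mulE msuppU_le msuppU_le) !big_seq_fset1 !mcoeffUU.
Qed.

Lemma laurent_mulDl : left_distributive laurent_mul +%R.
Proof.
move=> f g h.
rewrite [X in _ = X + _](laurent_mulE (fsubsetUl _ (msupp g)) (fsubset_refl _)).
rewrite [X in _ = _ + X](laurent_mulE (fsubsetUr (msupp f) _) (fsubset_refl _)).
rewrite (laurent_mulE (msuppD_le _ _) (fsubset_refl _)).
rewrite -big_split /=; apply/eq_bigr=> i _.
rewrite -big_split /=; apply/eq_bigr=> j _.
by rewrite mcoeffD mulrDl monalgUD.
Qed.

Lemma laurent_mulDr : right_distributive laurent_mul +%R.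
Proof. by move=> f g h; rewrite !(laurent_mulC f) laurent_mulDl. Qed.

Lemma laurent_mul0 : left_zero 0 laurent_mul.
Proof. by move=> f; rewrite laurent_mul.unlock msupp0 big_seq_fset0. Qed.

Lemma laurent_mulr0 : right_zero 0 laurent_mul.
Proof. by move=> f; rewrite laurent_mulC laurent_mul0. Qed.

Lemma laurent_ind (P : laurent -> Prop) :
    P 0 -> (forall f g, P f -> P g -> P (f + g)) ->
  (forall c i : int, P << c *g i >>) -> forall f, P f.
Proof.
by move=> P0 PD PU f; rewrite (monalgE f); elim/big_ind: _ => // i _.
Qed.

Lemma laurent_mulA : associative laurent_mul.
Proof.
move=> f g h; elim/laurent_ind: f => [|f1 f2 e1 e2|c i].
- by rewrite !laurent_mul0.
- by rewrite !laurent_mulDl e1 e2.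
elim/laurent_ind: g => [|g1 g2 e1 e2|d j].
- by rewrite !(laurent_mul0, laurent_mulr0).
- by rewrite !(laurent_mulDl, laurent_mulDr) e1 e2.
elim/laurent_ind: h => [|h1 h2 e1 e2|e k].
- by rewrite !laurent_mulr0.
- by rewrite !laurent_mulDr e1 e2.
by rewrite !laurent_mulUU mulrA addrA.
Qed.

Lemma laurent_mul1 : left_id (laurentX 0) laurent_mul.
Proof.
elim/laurent_ind => [|f g ef eg|c i].
- by rewrite laurent_mulr0.
- by rewrite laurent_mulDr ef eg.
by rewrite laurent_mulUU mul1r add0r.
Qed.

Lemma laurentX0_neq0 : laurentX 0 != 0.
Proof. by apply/eqP/malgP=> /(_ 0) /eqP; rewrite mcoeffU mcoeff0. Qed.

HB.instance Definition _ := GRing.Zmodule_isComNzRing.Build laurent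
  laurent_mulA laurent_mulC laurent_mul1 laurent_mulDl laurentX0_neq0.

Lemma laurentXD (a b : int) : laurentX (a + b) = laurentX a * laurentX b.
Proof. by rewrite [RHS]laurent_mulUU mulr1. Qed.

Lemma laurentX0 : laurentX 0 = 1.
Proof. by []. Qed.

End LaurentRing.

Definition ZwrZ : Type := (laurent * int)%type.

HB.instance Definition _ := Choice.copy ZwrZ (laurent * int)%type.

Section ZwrZGroup.

Implicit Types x y z : ZwrZ.

Definition ZwrZ_mul x y : ZwrZ := (x.1 + laurentX x.2 * y.1, x.2 + y.2).
Definition ZwrZ_one : ZwrZ := (0, 0).
Definition ZwrZ_inv x : ZwrZ := (- (laurentX (- x.2) * x.1), - x.2).

Lemma ZwrZ_mulA : associative ZwrZ_mul.
Proof.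
move=> [f a] [g b] [h c]; rewrite /ZwrZ_mul /=.
by rewrite laurentXD mulrDr !addrA mulrA.
Qed.

Lemma ZwrZ_mul1 : left_id ZwrZ_one ZwrZ_mul.
Proof. by case=> f b; rewrite /ZwrZ_mul /= !add0r laurentX0 mul1r. Qed.

Lemma ZwrZ_mulr1 : right_id ZwrZ_one ZwrZ_mul.
Proof. by case=> f b; rewrite /ZwrZ_mul /= mulr0 !addr0. Qed.

Lemma ZwrZ_mulV : left_inverse ZwrZ_one ZwrZ_inv ZwrZ_mul.
Proof. by case=> f b; rewrite /ZwrZ_mul /= !addNr. Qed.

Lemma ZwrZ_mulrV : right_inverse ZwrZ_one ZwrZ_inv ZwrZ_mul.
Proof.
case=> f b; rewrite /ZwrZ_mul /= mulrN mulrA -laurentXD.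
by rewrite subrr laurentX0 mul1r subrr.
Qed.

HB.instance Definition _ := isGroup.Build ZwrZ
  ZwrZ_mulA ZwrZ_mul1 ZwrZ_mulr1 ZwrZ_mulV ZwrZ_mulrV.

End ZwrZGroup.

Inductive letter (G : Type) (n : nat) : Type :=
  | Var of 'I_n
  | VarInv of 'I_n
  | Const of G.

Arguments Var {G n} i.
Arguments VarInv {G n} i.
Arguments Const {G n} c.

Record system (G : Type) : Type := System {
  nvars : nat;
  eqns : seq (seq (letter G nvars))
}.

Section Solvability.

Variable G : groupType.

Local Open Scope group_scope.

Definition letter_eval n (g : 'I_n -> G) (l : letter G n) : G :=
  match l with
  | Var i => g i
  | VarInv i => (g i)^-1
  | Const c => c
  end.

Definition word_eval n (g : 'I_n -> G) (w : seq (letter G n)) : G :=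
  \prod_(l <- w) letter_eval g l.

Definition solvable (S : system G) : Prop :=
  exists g : 'I_(nvars S) -> G, all (fun w => word_eval g w == 1) (eqns S).

End Solvability.

(* Syntax of the partial recursive functions N^k -> N.  In RPrec, argument 0
   is the recursion variable and the step function takes the recursion
   variable, the previous value and the parameters, in that order; in RMin,
   argument 0 is the variable that is minimized. *)
Inductive recfun : nat -> Type :=
  | RZero k : recfun k
  | RSucc : recfun 1
  | RProj k : 'I_k -> recfun k
  | RComp k m : recfun m -> ('I_m -> recfun k) -> recfun k
  | RPrec k : recfun k -> recfun k.+2 -> recfun k.+1
  | RMin k : recfun k.+1 -> recfun k.

(* [recfun_graph f v r]: f is defined at v, with value r. *)
Fixpoint recfun_graph k (f : recfun k) : k.-tuple nat -> nat -> Prop :=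
  match f in recfun k return k.-tuple nat -> nat -> Prop with
  | RZero _ => fun _ r => r = 0%N
  | RSucc => fun v r => r = (thead v).+1
  | RProj _ i => fun v r => r = tnth v i
  | RComp _ m f gs => fun v r => exists w : m.-tuple nat,
      (forall i, recfun_graph (gs i) v (tnth w i)) /\ recfun_graph f w r
  | RPrec _ f g => fun v r => exists s : nat -> nat,
      [/\ recfun_graph f (behead_tuple v) (s 0%N),
          forall i, (i < thead v)%N ->
            recfun_graph g [tuple of i :: s i :: behead_tuple v] (s i.+1)
        & r = s (thead v)]
  | RMin _ f => fun v r =>
      recfun_graph f [tuple of r :: v] 0%N /\
      forall i, (i < r)%N -> exists y, recfun_graph f [tuple of i :: v] y.+1
  end.

Definition decidable_problem (T : Type) (code : T -> nat) (P : T -> Prop) :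
    Prop :=
  exists d : recfun 1, forall x : T,
    (P x -> recfun_graph d [tuple code x] 1%N) /\
    (~ P x -> recfun_graph d [tuple code x] 0%N).

(* Instances are presented as natural numbers through the bijection
   [CodeSeq.code : seq nat -> nat].  A Laurent polynomial is presented by the
   list of its pairs (exponent, nonzero coefficient), by increasing exponent. *)
Definition code_int (z : int) : nat :=
  match z with Posz n => n.*2 | Negz n => n.*2.+1 end.

Definition code_laurent (f : laurent) : nat :=
  CodeSeq.code [seq CodeSeq.code [:: code_int k; code_int f@_k]
               | k <- sort <=%R (msupp f)].

Definition code_ZwrZ (x : ZwrZ) : nat :=
  CodeSeq.code [:: code_laurent x.1; code_int x.2].

Definition code_letter (G : Type) (codeG : G -> nat) n (l : letter G n) : nat :=
  match l with
  | Var i => CodeSeq.code [:: 0%N; nat_of_ord i]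
  | VarInv i => CodeSeq.code [:: 1%N; nat_of_ord i]
  | Const c => CodeSeq.code [:: 2%N; codeG c]
  end.

Definition code_word (G : Type) (codeG : G -> nat) n (w : seq (letter G n)) :
    nat :=
  CodeSeq.code [seq code_letter codeG l | l <- w].

Definition code_system (G : Type) (codeG : G -> nat) (S : system G) : nat :=
  CodeSeq.code [:: nvars S; CodeSeq.code [seq code_word codeG w | w <- eqns S]].

Section CodeInjective.

Let code_inj : injective CodeSeq.code := can_inj CodeSeq.codeK.

Lemma code_int_inj : injective code_int.
Proof.
case=> m [] n /= e; have := congr1 odd e; rewrite /= ?odd_double // => _.
  by rewrite (double_inj e).
by case: e => /double_inj ->.
Qed.

Lemma code_laurent_inj : injective code_laurent.
Proof.
move=> f g /code_inj; pose pr h k := CodeSeq.code [:: code_int k; code_int h@_k].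
rewrite -![map _ _]/(map (pr _) _) => e.
have prE h1 h2 i j : pr h1 i = pr h2 j -> i = j /\ h1@_i = h2@_j.
  by move=> /code_inj[/code_int_inj-> /code_int_inj->].
have sub (h1 h2 : {malg int[int]}) k :
    map (pr h1) (sort <=%R (msupp h1)) = map (pr h2) (sort <=%R (msupp h2)) ->
  k \in msupp h1 -> h1@_k = h2@_k.
  move=> e12 kh1; have : pr h1 k \in map (pr h1) (sort <=%R (msupp h1)).
    by rewrite map_f // mem_sort.
  by rewrite e12 => /mapP[j _ /prE[<-]].
apply/malgP => k; have [kf|kf] := boolP (k \in msupp f); first exact: sub e kf.
have [kg|kg] := boolP (k \in msupp g); first exact/esym/(sub _ _ _ (esym e) kg).
by rewrite !mcoeff_outdom.
Qed.

Lemma code_ZwrZ_inj : injective code_ZwrZ.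
Proof.
by move=> [f a] [g b] /code_inj[/code_laurent_inj /= -> /code_int_inj /= ->].
Qed.

Lemma code_letter_inj (G : Type) (codeG : G -> nat) n :
  injective codeG -> injective (@code_letter G codeG n).
Proof.
move=> codeG_inj.
by case=> x [] y /code_inj[] //; [move/ord_inj-> | move/ord_inj-> | move/codeG_inj->].
Qed.

Lemma code_system_inj (G : Type) (codeG : G -> nat) :
  injective codeG -> injective (code_system codeG).
Proof.
move=> codeG_inj [m s] [n t] /code_inj[/= e]; case: _ / e t => t /code_inj.
by move/(inj_map (fun w v e => inj_map (code_letter_inj codeG_inj) (code_inj e)))->.
Qed.

End CodeInjective.

(* Main.v *)
From HB Require Import structures.
From mathcomp Require Import all_boot all_order all_algebra.
From mathcomp Require Import finmap ring lra zify.
From mathcomp.multinomials Require Import monalg.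
From Stdlib Require Import FunctionalExtensionality.
Require Import Defs.

(* A number n is represented by the group element (0, n) and a Laurent
   polynomial f by (f, 0); conjugating the latter by the former multiplies f by
   X^n.  For integers a, b, c, the polynomial
   (X^a - 1)(X^b - 1) - (X - 1)(X^c - 1) is divisible by (X - 1)^3 if and only
   if c = ab, and for b = m^2 + n^2 + 2 the congruence
   X^(mb) - 1 = (X^b - 1) X^n modulo ((X^b - 1)(X - 2), (X^b - 1)^2)
   holds if and only if n >= 0 and m = 2^n.  Hence addition, multiplication and
   exponentiation of natural numbers are definable by systems of equations.

   A bounded universal quantifier in front of a Diophantine predicate is
   eliminated by exponentiation, in the manner of Davis, Putnam and Robinson;
   as the graph of a recursive function is exists Y, forall k <= Y, D(k, Y) with
   D Diophantine, it is definable by a system.  A decision procedure d then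
   yields a system with two parameters which, when they are given its own
   number of variables and code, is solvable exactly when d rejects it. *)

Set Implicit Arguments.
Unset Strict Implicit.
Unset Printing Implicit Defensive.

Import Order.TTheory GRing.Theory Num.Theory.

Local Open Scope ring_scope.

(** Group equations give sums of polynomials and, by conjugation, multiplication by X^b, but not
    directly the product of two unknown polynomials. Hence the congruences have moduli built from
    X^b - 1 and X - 2, and their cofactors become unknowns that are forced to be polynomials.
    Eliminating a bounded quantifier compares both sides of an equation modulo a prime, so the
    matrix has to be polynomial, whereas the outcome contains powers, binomial coefficients and
    factorials. It is therefore applied once only: the quantifiers in the graph of a recursive
    function are beforehand compressed into the single alternation [cdef], whose closure properties
    rest on polynomial coding alone. *)

(** * Laurent polynomials: linear functionals and congruences *)

Definition laurent_lin (V : zmodType) (h : int -> V) (f : laurent) : V :=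
  \sum_(k <- msupp f) h k *~ f@_k.

Section LaurentLin.

Variables (V : zmodType) (h : int -> V).

Lemma laurent_lin_wide (d : {fset int}) (f : laurent) :
  (msupp f `<=` d)%fset -> laurent_lin h f = \sum_(k <- d) h k *~ f@_k.
Proof.
by move=> le; apply: big_fset_incl => // k _ /mcoeff_outdom ->; rewrite mulr0z.
Qed.

Lemma laurent_linD f g : laurent_lin h (f + g) = laurent_lin h f + laurent_lin h g.
Proof.
rewrite (laurent_lin_wide (msuppD_le f g)).
rewrite (laurent_lin_wide (fsubsetUl _ (msupp g))).
rewrite (laurent_lin_wide (fsubsetUr (msupp f) _)).
by rewrite -big_split; apply/eq_bigr => k _; rewrite mcoeffD mulrzDr.
Qed.

Lemma laurent_lin0 : laurent_lin h 0 = 0.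
Proof. by rewrite /laurent_lin msupp0 big_seq_fset0. Qed.

Lemma laurent_linN f : laurent_lin h (- f) = - laurent_lin h f.
Proof. by apply/eqP; rewrite -addr_eq0 -laurent_linD addNr laurent_lin0. Qed.

Lemma laurent_linB f g : laurent_lin h (f - g) = laurent_lin h f - laurent_lin h g.
Proof. by rewrite laurent_linD laurent_linN. Qed.

Lemma laurent_linU (c k : int) : laurent_lin h << c *g k >> = h k *~ c.
Proof. by rewrite (laurent_lin_wide msuppU_le) big_seq_fset1 mcoeffUU. Qed.

Lemma laurent_linX (k : int) : laurent_lin h (laurentX k) = h k.
Proof. by rewrite laurent_linU. Qed.

End LaurentLin.

Definition laurent_eval (F : fieldType) (u : F) : laurent -> F :=
  laurent_lin (fun k => u ^ k).

Lemma laurent_evalM (F : fieldType) (u : F) f g : u != 0 ->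
  laurent_eval u (f * g) = laurent_eval u f * laurent_eval u g.
Proof.
move=> u0; rewrite /laurent_eval; elim/laurent_ind: f => [|f1 f2 e1 e2|c i].
- by rewrite mul0r !laurent_lin0 mul0r.
- by rewrite mulrDl !laurent_linD mulrDl e1 e2.
elim/laurent_ind: g => [|g1 g2 e1 e2|d j].
- by rewrite mulr0 !laurent_lin0 mulr0.
- by rewrite mulrDr !laurent_linD mulrDr e1 e2.
rewrite [X in laurent_lin _ X]laurent_mulUU !laurent_linU expfzDr //.
by rewrite mulrzAl mulrzAr -mulrzA [d * c]mulrC.
Qed.

Lemma laurent_eval2_dyadic f :
  exists (K : nat) (z : int), laurent_eval (2 : rat) f * 2 ^+ K = z%:~R.
Proof.
have n2 : (2 : rat) != 0 by [].
move: (2 : rat) n2 (erefl : 2 = 2%:~R :> rat) => u u0 uE.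
rewrite /laurent_eval; elim/laurent_ind: f => [|f g [K [y ey]] [L [z ez]]|c i].
- by exists 0%N, 0; rewrite laurent_lin0 mul0r.
- exists (K + L)%N, (y * 2 ^+ L + z * 2 ^+ K).
  rewrite laurent_linD exprD mulrDl mulrA ey mulrCA ez rmorphD !rmorphM !rmorphXn /=.
  by rewrite -uE [_ * z%:~R]mulrC.
exists `|i|%N, (c * 2 ^+ absz (i + `|i|%N)).
rewrite laurent_linU -mulrzl -mulrA rmorphM rmorphXn /= -uE; congr (_ * _).
by rewrite !exprnP -expfzDr //; congr (_ ^ _); lia.
Qed.

(** Induction on m in both directions: to first order in x - 1, the power X m is 1 + m (x - 1).
    Working in an abstract ring with y as the inverse of x lets [ring] treat negative exponents. *)
Lemma unit_exp_sub1 (R : comNzRingType) (x y : R) (X : int -> R) :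
    x * y = 1 -> X 0 = 1 -> {morph X : a b / a + b >-> a * b} -> X 1 = x -> X (-1) = y ->
  forall m : int, exists z, X m - 1 = (x - 1) * (m%:~R + (x - 1) * z).
Proof.
move=> xy X0 XD X1 XN1; elim/int_rect => [|m [z ez]|m [z ez]].
- by exists 0; rewrite X0; ring.
- exists (m%:~R + x * z); rewrite intS XD X1 rmorphD /=.
  have -> : X m = (x - 1) * (m%:~R + (x - 1) * z) + 1 by rewrite -ez; ring.
  by ring.
exists (y * (z + m%:~R + 1)); rewrite intS opprD XD XN1 rmorphD /=.
have -> : X (- m%:Z) = (x - 1) * ((- m%:Z)%:~R + (x - 1) * z) + 1.
  by rewrite -ez; ring.
rewrite !rmorphN /=; move: (m%:~R : R) => k.
apply/eqP; rewrite -subr_eq0; apply/eqP.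
(* The relation xy = 1 is unknown to [ring], so the difference of the two sides is displayed as a
   multiple of xy - 1. *)
transitivity ((x * y - 1) * (1 - (x - 1) * (k + 1))); last by rewrite xy subrr mul0r.
by ring.
Qed.

Lemma laurentX_mul_sub1 (b m : int) : exists z : laurent,
  laurentX (m * b) - 1 = (laurentX b - 1) * (m%:~R + (laurentX b - 1) * z).
Proof.
apply: (@unit_exp_sub1 laurent _ (laurentX (- b)) (fun m => laurentX (m * b))).
- by rewrite -laurentXD subrr laurentX0.
- by rewrite mul0r laurentX0.
- by move=> i j /=; rewrite mulrDl laurentXD.
- by rewrite mul1r.
by rewrite mulN1r.
Qed.

HB.instance Definition _ (V : zmodType) (h : int -> V) :=
  GRing.isZmodMorphism.Build laurent V (laurent_lin h) (laurent_linB h).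

Lemma laurent_lin_eq0 (V : zmodType) (h : int -> V) f :
  (forall k, h k = 0) -> laurent_lin h f = 0.
Proof. by move=> h0; rewrite /laurent_lin big1 // => k _; rewrite h0 mul0rz. Qed.

(** Multiplication by X^b - 1 is adjoint to the difference operator of step b, so a functional on a
    product of such factors becomes an iterated difference of h. *)
Lemma laurent_lin_mulX_sub1 (V : zmodType) (h : int -> V) b f :
  laurent_lin h ((laurentX b - 1) * f) = laurent_lin (fun k => h (b + k) - h k) f.
Proof.
elim/laurent_ind: f => [|f g ef eg|c k].
- by rewrite mulr0 !laurent_lin0.
- by rewrite mulrDr !laurent_linD ef eg.
rewrite mulrBl mul1r laurent_linB [X in laurent_lin _ X - _]laurent_mulUU mul1r.
by rewrite !laurent_linU mulrzBl.
Qed.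

(* The functional sum_k f_k k^2 sends (X^a - 1)(X^b - 1) to 2ab and kills the
   multiples of (X - 1)^3, because the third difference of k^2 vanishes. *)
Lemma laurent_mulP (a b c : int) :
  (exists g : laurent, (laurentX a - 1) * (laurentX b - 1) =
     (laurentX 1 - 1) *
       (laurentX c - 1 + (laurentX 1 - 1) * ((laurentX 1 - 1) * g)))
  <-> c = a * b.
Proof.
split=> [[g /(congr1 (laurent_lin (fun k => k * k)))]|->].
  rewrite [X in _ = laurent_lin _ X]mulrDr laurent_linD.
  rewrite -[laurentX b - 1]mulr1 -[laurentX c - 1]mulr1 -laurentX0.
  rewrite !laurent_lin_mulX_sub1 !laurent_linX.
  by rewrite [X in _ = _ + X]laurent_lin_eq0 => [|k]; [lia | ring].
have [x ex] := laurentX_mul_sub1 1 a; have [y ey] := laurentX_mul_sub1 1 b.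
have [z ez] := laurentX_mul_sub1 1 (a * b); rewrite !mulr1 rmorphM /= in ex ey ez.
exists (a%:~R * y + b%:~R * x + (laurentX 1 - 1) * x * y - z).
by rewrite ex ey ez; ring.
Qed.

(** Squares dominate absolute values, so b >= n + |m| + 2 and 2^b >= 4 * 2^n * 2^|m|. The squares
    give such a bound from products alone, without a sign test; the second inequality serves
    negative exponents. *)
Lemma dvd_pow2_bound (n : nat) (m b : int) :
  m * m + n%:Z * n%:Z + 2 <= b ->
  (`|2 ^+ n - m| < 2 ^+ absz b - 1) /\ (`|1 - m * 2 ^+ n| < 2 ^+ absz b - 1).
Proof.
move=> le_b; have le : (n + absz m + 2 <= absz b)%N.
  have sq (k : nat) : k%:Z <= k%:Z * k%:Z.
    by rewrite -PoszM lez_nat; case: k => // k; exact: leq_pmulr.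
  have mm : m * m = (absz m)%:Z * (absz m)%:Z.
    by rewrite !abszE -normrM ger0_norm // -expr2 sqr_ge0.
  by move: (sq n) (sq (absz m)) le_b; rewrite mm; lia.
have := ltn_expl (absz m) (erefl (1 < 2)%N).
have : (2 ^ (n + absz m + 2) <= 2 ^ absz b)%N by rewrite leq_exp2l.
rewrite !expnD -mulnA mulnA; set A := (2 ^ n)%N; set B := (2 ^ absz m)%N.
have A1 : (0 < A)%N by rewrite expn_gt0.
have e (k : nat) : (2 : int) ^+ k = (2 ^ k)%N by rewrite -natrX natz.
rewrite !e -/A; move: (2 ^ absz b)%N => C hC hB.
have hm : m = absz m \/ m = - (absz m)%:Z by lia.
have hA : (absz m * A + A <= A * B)%N by rewrite -mulSnr mulnC leq_mul2l hB orbT.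
have hAB : (A <= A * B)%N by lia.
move: (absz m) (A * B)%N hB hm hA hAB hC => k P hB hm hA hAB hC.
by split; case: hm => ->; nia.
Qed.

(* Evaluating at X = 2 gives 2^n = m modulo 2^b - 1 in Z[1/2], and b is large
   enough to turn the congruence into an equality. *)
Lemma laurent_pow2P (n m b c : int) : b = m * m + n * n + 2 -> c = m * b ->
  (exists g h : laurent, laurentX c - 1 =
     (laurentX b - 1) * (laurentX n + (laurentX 1 * g - g - g) + (laurentX b - 1) * h))
  <-> exists k : nat, n = k /\ m = 2 ^+ k.
Proof.
move=> eb ->; have [z ez] := laurentX_mul_sub1 b m.
split=> [[g [h]]|[k [en em]]]; last first.
  suff [g eg] : exists g : laurent, laurentX k - 2 ^+ k = laurentX 1 * g - g - g.
    exists (- g), z; rewrite ez em en; congr (_ * (_ + _)).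
    rewrite rmorphXn /= -[_ ^+ k]/((2 : laurent) ^+ k).
    have -> : laurentX k = laurentX 1 * g - g - g + 2 ^+ k by rewrite -eg subrK.
    by ring.
  elim: k {en em} => [|k [g eg]]; first by exists 0; rewrite laurentX0; ring.
  exists (laurentX k + 2 * g); rewrite intS laurentXD exprS.
  have -> : laurentX k = laurentX 1 * g - g - g + 2 ^+ k by rewrite -eg subrK.
  by ring.
have n2 : (2 : rat) != 0 by [].
rewrite ez; set q := laurentX b - 1.
move=> /(congr1 (laurent_eval (2 : rat))).
rewrite !laurent_evalM //; set ev := laurent_eval _.
have evD f1 f2 : ev (f1 + f2) = ev f1 + ev f2 by exact: laurent_linD.
have evB f1 f2 : ev (f1 - f2) = ev f1 - ev f2 by exact: laurent_linB.
have evX k : ev (laurentX k) = 2 ^ k by exact: laurent_linX.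
have evz (k : int) : ev k%:~R = k%:~R.
  by rewrite /ev /laurent_eval raddfMz /= -laurentX0 laurent_linX.
have evM f1 f2 : ev (f1 * f2) = ev f1 * ev f2 by exact: laurent_evalM.
have b2 : 2 <= b by nia.
have [Q QE] : exists Q : int, Q = 2 ^+ absz b - 1 by eexists.
have evq : ev q = Q%:~R.
  rewrite evB -laurentX0 !evX QE rmorphB rmorphXn /= -{1}[b]gez0_abs //; lia.
have Q3 : 3 <= Q.
  have : (2 ^ 2 <= 2 ^ absz b)%N by rewrite leq_exp2l //; lia.
  rewrite QE -natrX natz; lia.
have Q0 : Q%:~R != 0 :> rat by rewrite intr_eq0; lia.
rewrite !(evq, evB, evD, evM, evX, evz) => /(mulfI Q0).
have [K [w ew]] := laurent_eval2_dyadic (z - h).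
move: ew; rewrite -/ev evB; move: (ev z) (ev h) (ev g) => Z H G ew e.
have {}e : 2 ^ n - m%:~R = Q%:~R * (Z - H) :> rat.
  have {}e : m%:~R + Q%:~R * Z = 2 ^ n + Q%:~R * H by rewrite e expr1z; ring.
  by rewrite mulrBr; move: (Q%:~R * Z) (Q%:~R * H) e => QZ QH e; lra.
have Qdvd (k v : int) : k * 2 ^+ K = Q * v -> `|k| < Q -> k = 0.
  move=> ev2 ltk; have : (Q %| k * 2 ^+ K)%Z by rewrite ev2 dvdz_mulr.
  rewrite Gauss_dvdzl; last first.
    (* The Bezout relation 2 * 2^(b-1) - Q = 1 makes Q coprime to the denominator 2^K. *)
    apply: coprimezXr; apply/coprimezP; exists (-1, 2 ^+ (absz b).-1).
    by rewrite /= -exprSr prednK ?QE; [ring | lia].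
  move=> /dvdzP[s es]; move: ltk; rewrite es.
  have [->|[] hs] : s = 0 \/ 1 <= s \/ s <= -1 by lia.
  - by rewrite mul0r.
  - have : 0 <= (s - 1) * Q by rewrite mulr_ge0; lia.
    by rewrite mulrBl mul1r; lia.
  have : 0 <= (- s - 1) * Q by rewrite mulr_ge0; lia.
  by rewrite mulrBl mulNr mul1r; lia.
have [|h1 h2] := @dvd_pow2_bound (absz n) m b.
  by rewrite eb !abszE -normrM ger0_norm // -expr2 sqr_ge0.
rewrite -QE in h1 h2; case: (lerP 0 n) => n0.
  have en : n = absz n by lia.
  exists (absz n); split; first by []. apply/esym/eqP; rewrite -subr_eq0; apply/eqP.
  apply: (Qdvd _ w); last first.
    exact: h1.
  apply: (@intr_inj rat); rewrite !rmorphM rmorphB !rmorphXn /=.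
  by rewrite -ew mulrA; congr (_ * _); rewrite -e {2}en.
(* Negative exponent: clearing 2^|n| leads to m * 2^|n| = 1, impossible for an integer m. *)
have en : n = - (absz n)%:Z by lia.
suff : 1 - m * 2 ^+ absz n = 0.
  have : 2 <= 2 ^+ absz n :> int.
    have : (2 ^ 1 <= 2 ^ absz n)%N by rewrite leq_exp2l //; lia.
    have -> : 2 ^+ absz n = (2 ^ absz n)%N :> int by rewrite -natrX natz.
    by move: (2 ^ absz n)%N; lia.
  move: (2 ^+ absz n) => A hA hm.
  have [|] := lerP m 0; first by nia.
  move=> m0; have : 0 <= (m - 1) * A by rewrite mulr_ge0; lia.
  by rewrite mulrBl mul1r; lia.
apply: (Qdvd _ (w * 2 ^+ absz n) _ h2).
apply: (@intr_inj rat); rewrite !(rmorphM, rmorphB, rmorphXn) /=.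
rewrite -ew.
have e1 : 2 ^ n * 2 ^+ absz n = 1 :> rat.
  by rewrite [in 2 ^ n]en -exprnN mulVf // expf_neq0.
transitivity ((2 ^ n - m%:~R) * 2 ^+ absz n * 2 ^+ K : rat); first by rewrite [in RHS]mulrBl e1.
by rewrite e; ring.
Qed.

Local Close Scope ring_scope.

(** * Classes of predicates on environments *)

Definition scons (D : Type) (x : D) (e : nat -> D) (i : nat) : D :=
  if i is k.+1 then e k else x.

(* The even positions hold the free variables, the odd ones the existentially
   quantified ones. *)
Definition join (D : Type) (e w : nat -> D) (i : nat) : D :=
  if odd i then w i./2 else e i./2.

Lemma join_odd D (e w : nat -> D) i : join e w i.*2.+1 = w i.
Proof. by rewrite /join /= odd_double uphalf_double. Qed.

Lemma join_even D (e w : nat -> D) i : join e w i.*2 = e i.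
Proof. by rewrite /join odd_double doubleK. Qed.

(** Closure properties shared by systems over the group ([gdef]), their traces on the naturals
    ([ndef]), Diophantine predicates ([dio]) and [cdef]. Environments are in de Bruijn style: the
    quantifier binds variable 0. *)
Record env_class (D : Type) (C : ((nat -> D) -> Prop) -> Prop) : Prop := EnvClass {
  ec_ext : forall P Q, (forall e, P e <-> Q e) -> C P -> C Q;
  ec_ren : forall (r : nat -> nat) P, C P -> C (fun e => P (fun i => e (r i)));
  ec_and : forall P Q, C P -> C Q -> C (fun e => P e /\ Q e);
  ec_ex : forall P : D -> (nat -> D) -> Prop,
    C (fun e => P (e 0) (fun i => e i.+1)) -> C (fun e => exists x, P x e)
}.

Section EnvClassTheory.

Variables (D : Type) (C : ((nat -> D) -> Prop) -> Prop).
Hypothesis HC : env_class C.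

(** K variables are quantified at once, as a function a of which only the first K values matter; K
    may thus depend on the predicate. *)
Lemma ec_exs (K : nat) (P : (nat -> D) -> (nat -> D) -> Prop) :
    (forall a b e, (forall i, i < K -> a i = b i) -> P a e -> P b e) ->
    C (fun e => P e (fun i => e (K + i))) ->
  C (fun e => exists a, P a e).
Proof.
elim: K P => [|K IH] P PK CP.
  apply: (ec_ext HC) CP => e; split=> [Pe|[a Pa]]; first by exists e.
  by apply: PK Pa.
have ext e : (exists x a, P (scons x a) e) <-> exists a, P a e.
  split=> [[x [a Pa]]|[a Pa]]; first by exists (scons x a).
  exists (a 0), (fun i => a i.+1); apply: PK Pa => -[|i] //=.
apply: (ec_ext HC ext); apply: (ec_ex HC).
apply: (IH (fun a e => P (scons (e 0) a) (fun i => e i.+1))).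
  move=> a b e ab; apply: PK => -[|i] //=; exact: ab.
(* The outermost variable, entry 0 of a, sits at position K below the K inner quantifiers. *)
pose r i := if i is k.+1 then if k < K then k else k.+1 else K.
apply: (ec_ext HC _ (ec_ren HC r CP)) => e.
have -> : (fun i => e (r (K.+1 + i))) = (fun i => e (K + i.+1)).
  apply: functional_extensionality => i.
  by rewrite /r addSn /= ltnNge leq_addr addnS.
by split; apply: PK => -[|i] /=; rewrite /r ?addn0 // ltnS => ->.
Qed.

Lemma ec_all (T : eqType) (s : seq T) (P : T -> (nat -> D) -> Prop) :
    C (fun _ => True) -> (forall t, t \in s -> C (P t)) ->
  C (fun e => forall t, t \in s -> P t e).
Proof.
move=> CT; elim: s => [|t s IH] Cs; first by apply: (ec_ext HC _ CT).
have CP : C (fun e => P t e /\ forall t, t \in s -> P t e).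
  apply: (ec_and HC); first by apply: Cs; rewrite mem_head.
  by apply: IH => u us; apply: Cs; rewrite inE us orbT.
apply: (ec_ext HC _ CP) => e; split=> [[Pt Ps] u|Ps].
  by rewrite inE => /predU1P[->|/Ps].
by split=> [|u us]; apply: Ps; rewrite inE ?eqxx // us orbT.
Qed.

End EnvClassTheory.

Section ExistentialDefinability.

Variables (D A : Type) (sat : (nat -> D) -> A -> bool) (ren : (nat -> nat) -> A -> A).
Hypothesis sat_ren : forall r e a, sat e (ren r a) = sat (fun i => e (r i)) a.

(** The atoms are left abstract: group equations for [gdef], polynomial equations over the naturals
    for [dio]. *)
Definition edef (P : (nat -> D) -> Prop) : Prop :=
  exists s : seq A, forall e, P e <-> exists w, all (sat (join e w)) s.

Let all_ren r e s : all (sat e) (map (ren r) s) = all (sat (fun i => e (r i))) s.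
Proof. by rewrite all_map; apply: eq_all => a; rewrite /= sat_ren. Qed.

Lemma edef_sat (a : A) : edef (fun e => sat e a).
Proof.
exists [:: ren double a] => e.
have sE w : (fun i => join e w i.*2) = e.
  by apply: functional_extensionality => i; rewrite join_even.
split=> [sa|[w]]; last by rewrite /= sat_ren sE andbT.
by exists e; rewrite /= sat_ren sE sa.
Qed.

Lemma edef_env_class : env_class edef.
Proof.
split=> [P Q PQ [s sP]|r P [s sP]|P Q [s sP] [t tQ]|P [s sP]].
- by exists s => e; rewrite -PQ.
- pose r' i := if odd i then i else (r i./2).*2.
  have jr e w : (fun i => join e w (r' i)) = join (fun i => e (r i)) w.
    apply: functional_extensionality => i; rewrite /r' {2}/join.
    by case: ifP => oi; [rewrite /join oi | rewrite join_even].
  exists (map (ren r') s) => e.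
  by rewrite sP; split=> -[w hw]; exists w; move: hw; rewrite all_ren jr.
(* The witnesses of the two predicates are kept apart in the even and the odd entries of one
   family. *)
- pose r1 i := if odd i then i./2.*2.*2.+1 else i.
  pose r2 i := if odd i then i./2.*2.+1.*2.+1 else i.
  have j1 e w : (fun i => join e w (r1 i)) = join e (fun i => w i.*2).
    apply: functional_extensionality => i; rewrite /r1 {2}/join.
    by case: ifP => oi; [rewrite join_odd | rewrite /join oi].
  have j2 e w : (fun i => join e w (r2 i)) = join e (fun i => w i.*2.+1).
    apply: functional_extensionality => i; rewrite /r2 {2}/join.
    by case: ifP => oi; [rewrite join_odd | rewrite /join oi].
  exists (map (ren r1) s ++ map (ren r2) t) => e; split.
    move=> [/sP[w1 h1] /tQ[w2 h2]]; exists (join w1 w2).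
    rewrite all_cat !all_ren j1 j2.
    have -> : (fun i => join w1 w2 i.*2) = w1.
      by apply: functional_extensionality => i; rewrite join_even.
    have -> : (fun i => join w1 w2 i.*2.+1) = w2.
      by apply: functional_extensionality => i; rewrite join_odd.
    by rewrite h1.
  move=> [w]; rewrite all_cat !all_ren j1 j2 => /andP[h1 h2].
  by split; [apply/sP | apply/tQ]; eexists; eassumption.
(* The quantified variable becomes witness 0, and the other witnesses move up by one. *)
pose r i := if odd i then i./2.+1.*2.+1 else if i./2 is k.+1 then k.*2 else 1.
have jr e x w : (fun i => join e (scons x w) (r i)) = join (scons x e) w.
  apply: functional_extensionality => i; rewrite /r {2}/join.
  case: ifP => oi; first by rewrite join_odd.
  by case: (i./2) => [|k] //=; rewrite join_even.
exists (map (ren r) s) => e; split.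
  by move=> [x /(sP (scons x e))[w hw]]; exists (scons x w); rewrite all_ren jr.
move=> [w hw]; exists (w 0); apply/(sP (scons (w 0) e)); exists (fun i => w i.+1).
rewrite -jr -all_ren.
by have -> : scons (w 0) (fun i => w i.+1) = w by apply: functional_extensionality => -[].
Qed.

End ExistentialDefinability.

(** * Numbers, polynomials and arithmetic inside Z wr Z *)

Lemma laurent_mcoeff_mulX (b k : int) (f : laurent) :
  ((laurentX b * f)%R : {malg int[int]})@_k = (f : {malg int[int]})@_(k - b)%R.
Proof.
elim/laurent_ind: f => [|f g ef eg|c i].
- by rewrite mulr0 !mcoeff0.
- by rewrite mulrDr !mcoeffD ef eg.
rewrite [X in X@__]laurent_mulUU mul1r !mcoeffU.
by rewrite [(b + i)%R]addrC -subr_eq0 -[in RHS]subr_eq0 opprB addrA.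
Qed.

(** X f = f makes the coefficients constant along Z, while the support is finite. *)
Lemma laurentX_sub1_inj (f : laurent) : (laurentX 1 * f = f)%R -> f = 0%R.
Proof.
move=> ef; have step k : f@_(k + 1)%R = f@_k.
  by rewrite -{1}ef laurent_mcoeff_mulX addrK.
have shift k (n : nat) : f@_(k + n%:Z)%R = f@_k.
  elim: n => [|n IH]; first by rewrite addr0.
  by rewrite intS [(1 + _)%R]addrC addrA step.
apply/malgP => k; rewrite mcoeff0.
(* With this n, the exponent k + n is farther from k than any exponent of f. *)
pose n := (\sum_(i <- msupp f) absz (i - k)%R).+1.
rewrite -(shift k n); apply: mcoeff_outdom; apply/negP => kn.
have : (absz (k + n%:Z - k)%R <= \sum_(i <- msupp f) absz (i - k)%R)%N.
  by rewrite (big_rem _ kn) /= leq_addr.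
by rewrite addrC addKr ltnn.
Qed.

Local Open Scope group_scope.

Definition num (n : int) : ZwrZ := (0%R, n).
Definition pol (f : laurent) : ZwrZ := (f, 0%R).
(** The commutator: on a number b and a polynomial f it multiplies f by X^b - 1. *)
Definition brk (x y : ZwrZ) : ZwrZ := x * y * x^-1 * y^-1.

Lemma numM a b : num a * num b = num (a + b)%R.
Proof. by congr pair; rewrite /= mulr0 addr0. Qed.

Lemma numV a : (num a)^-1 = num (- a)%R.
Proof. by congr pair; rewrite /= mulr0 oppr0. Qed.

Lemma polM f g : pol f * pol g = pol (f + g)%R.
Proof. by congr pair; rewrite /= laurentX0 mul1r. Qed.

Lemma polV f : (pol f)^-1 = pol (- f)%R.
Proof. by congr pair; rewrite /= oppr0 laurentX0 mul1r. Qed.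

Lemma num_pol b f : num b * pol f * (num b)^-1 = pol (laurentX b * f)%R.
Proof.
rewrite numV; congr pair; rewrite /=.
  by rewrite mulr0 add0r addr0.
by rewrite addr0 addrN.
Qed.

Lemma brk_num_pol b f : brk (num b) (pol f) = pol ((laurentX b - 1) * f)%R.
Proof. by rewrite /brk num_pol polV polM mulrBl mul1r. Qed.

Lemma pol_inj : injective pol.
Proof. by move=> f g []. Qed.

Lemma num_inj : injective num.
Proof. by move=> f g []. Qed.

(** Numbers and polynomials are the centralizers of (0, 1) and (1, 0), so each sort is cut out by
    one equation. Here the reason is that X f = f forces f = 0. *)
Lemma centralizer_num (x : ZwrZ) : x * num 1 = num 1 * x <-> exists n, x = num n.
Proof.
split=> [|[n ->]]; last by rewrite !numM addrC.
case: x => f n h; exists n; congr pair; apply: laurentX_sub1_inj.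
have : (f + laurentX n * 0 = 0 + laurentX 1 * f)%R := congr1 fst h.
by rewrite mulr0 addr0 add0r.
Qed.

(** Commuting with (1, 0) means X^n = 1, hence n = 0. *)
Lemma centralizer_pol (x : ZwrZ) : x * pol 1%R = pol 1%R * x <-> exists f, x = pol f.
Proof.
split=> [|[f ->]]; last by rewrite !polM addrC.
case: x => f n h; exists f; congr pair.
have : (f + laurentX n * 1 = 1 + laurentX 0 * f)%R := congr1 fst h.
rewrite laurentX0 mul1r mulr1 [RHS]addrC => /addrI e.
apply/eqP; move/(congr1 (fun g : {malg int[int]} => g@_(0 : int)))/eqP: e.
rewrite -laurentX0 !mcoeffU. by rewrite eqxx; case: (n =P 0%R) .
Qed.

Inductive gterm : Type :=
  | GVar of nat
  | GConst of ZwrZ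
  | GMul of gterm & gterm
  | GInv of gterm.

Fixpoint geval (e : nat -> ZwrZ) (t : gterm) : ZwrZ :=
  match t with
  | GVar i => e i
  | GConst c => c
  | GMul t1 t2 => geval e t1 * geval e t2
  | GInv t1 => (geval e t1)^-1
  end.

Fixpoint gren (r : nat -> nat) (t : gterm) : gterm :=
  match t with
  | GVar i => GVar (r i)
  | GConst c => GConst c
  | GMul t1 t2 => GMul (gren r t1) (gren r t2)
  | GInv t1 => GInv (gren r t1)
  end.

Definition gsat (e : nat -> ZwrZ) (t : gterm) : bool := geval e t == 1.

Lemma gsat_ren r e t : gsat e (gren r t) = gsat (fun i => e (r i)) t.
Proof.
rewrite /gsat; congr (_ == _).
by elim: t => //= [t1 -> t2 ->|t1 ->].
Qed.

Definition gdef : ((nat -> ZwrZ) -> Prop) -> Prop := edef gsat.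

Lemma gdef_class : env_class gdef.
Proof. exact: edef_env_class gsat_ren. Qed.

Definition gfun (F : (nat -> ZwrZ) -> ZwrZ) : Prop :=
  exists t, forall e, F e = geval e t.

Lemma gfun_var i : gfun (fun e => e i). Proof. by exists (GVar i). Qed.
Lemma gfun_const c : gfun (fun _ => c). Proof. by exists (GConst c). Qed.
Lemma gfun_mul F H : gfun F -> gfun H -> gfun (fun e => F e * H e).
Proof. by move=> [s sE] [t tE]; exists (GMul s t) => e /=; rewrite sE tE. Qed.
Lemma gfun_inv F : gfun F -> gfun (fun e => (F e)^-1).
Proof. by move=> [s sE]; exists (GInv s) => e /=; rewrite sE. Qed.
Lemma gfun_brk F H : gfun F -> gfun H -> gfun (fun e => brk (F e) (H e)).
Proof. by move=> hF hH; apply: gfun_mul (gfun_mul (gfun_mul hF hH) (gfun_inv hF)) (gfun_inv hH). Qed.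

Lemma gdef_eq F H : gfun F -> gfun H -> gdef (fun e => F e = H e).
Proof.
move=> [s sE] [t tE].
apply: (ec_ext gdef_class) (edef_sat gsat_ren (GMul s (GInv t))) => e.
rewrite /gsat /= -sE -tE; split=> [/eqP eFH|->]; last by rewrite mulgV.
by rewrite -[F e](mulgVK (H e)) eFH mul1g.
Qed.

Ltac gfun_tac := repeat first
  [ assumption
  | lazymatch goal with
    | |- gfun (fun e => brk (@?f e) (@?h e)) => refine (@gfun_brk f h _ _)
    | |- gfun (fun e => (@?f e * @?h e)%g) => refine (@gfun_mul f h _ _)
    | |- gfun (fun e => ((@?f e)^-1)%g) => refine (@gfun_inv f _)
    | |- gfun (fun e => e ?i) => exact (gfun_var i)
    | |- gfun (fun e => ?c) => exact (gfun_const c)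
    end ].

Lemma gdef_num F : gfun F -> gdef (fun e => exists n, F e = num n).
Proof.
move=> hF; apply: (ec_ext gdef_class (fun e => centralizer_num (F e))).
by apply: gdef_eq; gfun_tac.
Qed.

Lemma gdef_pol F : gfun F -> gdef (fun e => exists f, F e = pol f).
Proof.
move=> hF; apply: (ec_ext gdef_class (fun e => centralizer_pol (F e))).
by apply: gdef_eq; gfun_tac.
Qed.

(** The equation of [laurent_mulP], its factors X^b - 1 being produced by commutators; the unknown p
    is the cofactor of (X - 1)^3. *)
Definition gmul (x y z : ZwrZ) : Prop :=
  (exists a, x = num a) /\ (exists b, y = num b) /\ (exists c, z = num c) /\
  exists p, (exists f, p = pol f) /\
        brk x (brk y (pol 1%R)) = brk (num 1) (brk z (pol 1%R) * brk (num 1) (brk (num 1) p)).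

Lemma gmulP x y z :
  gmul x y z <-> exists a b, [/\ x = num a, y = num b & z = num (a * b)%R].
Proof.
split=> [[[a ->] [[b ->] [[c ->] [_ [[f ->]]]]]]|[a [b [-> -> ->]]]].
  rewrite !(brk_num_pol, polM) !mulr1 => /pol_inj e; exists a, b; split=> //.
  by congr num; apply/laurent_mulP; exists f.
split; first by exists a.
split; first by exists b.
split; first by exists (a * b)%R.
have [f e] := (laurent_mulP a b _).2 (erefl (a * b)%R); exists (pol f).
by split; [exists f | rewrite !(brk_num_pol, polM) !mulr1 e].
Qed.

(** The congruence of [laurent_pow2P]: the conjugate of [pol 1] by x is X^n, the product around g is
    (X - 2) g, and [brk b h] is (X^b - 1) h. *)
Definition gpow2 (x y : ZwrZ) : Prop :=
  exists xx yy b c g h, gmul x x xx /\ gmul y y yy /\ b = yy * xx * num 1 * num 1 /\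
    gmul y b c /\ (exists f, g = pol f) /\ (exists f, h = pol f) /\
    brk c (pol 1%R) = brk b (x * pol 1%R * x^-1 * (num 1 * g * (num 1)^-1 * g^-1 * g^-1) * brk b h).

Lemma gpow2P x y :
  gpow2 x y <-> exists k : nat, x = num k /\ y = num (2 ^+ k)%R.
Proof.
split.
  move=> [xx [yy [b [c [g [h]]]]]] [/gmulP[n [_ [-> /num_inj<- ->]]]].
  move=> [/gmulP[m [_ [-> /num_inj<- ->]]]]; rewrite !numM => -[->].
  move=> [/gmulP[m' [b' [/num_inj<- /num_inj<- ->]]]] [[g' ->]] [[h' ->]].
  rewrite !(brk_num_pol, num_pol, polM, polV) !mulr1 => /pol_inj e.
  have eb : (m * m + n * n + 1 + 1 = m * m + n * n + 2 :> int)%R by rewrite -addrA.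
  have [|k [-> ->]] := (laurent_pow2P eb erefl).1; first by exists g', h'.
  by exists k.
move=> [k [-> ->]]; set n : int := k; set m : int := (2 ^+ k)%R.
pose b : int := (m * m + n * n + 1 + 1)%R.
have eb : (b = m * m + n * n + 2)%R by rewrite /b -addrA.
have [g [h e]] := (laurent_pow2P eb erefl).2 (ex_intro _ k (conj erefl erefl)).
exists (num (n * n)%R), (num (m * m)%R), (num b), (num (m * b)%R), (pol g), (pol h).
have gm a c : gmul (num a) (num c) (num (a * c)%R) by apply/gmulP; exists a, c.
split; first exact: gm.
split; first exact: gm.
split; first by rewrite !numM.
split; first exact: gm.
split; first by exists g.
split; first by exists h.
by rewrite !(brk_num_pol, num_pol, polM, polV) !mulr1 e.
Qed.

Ltac gdef_tac := repeat first
  [ apply: (ec_ex gdef_class) | apply: (ec_and gdef_class)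
  | apply: gdef_num | apply: gdef_pol | apply: gdef_eq ]; gfun_tac.

Lemma gdef_gmul i j k : gdef (fun e => gmul (e i) (e j) (e k)).
Proof. by rewrite /gmul; gdef_tac. Qed.

Lemma gdef_gpow2 i j : gdef (fun e => gpow2 (e i) (e j)).
Proof.
rewrite /gpow2; do 6 apply: (ec_ex gdef_class).
do 2 apply: (ec_and gdef_class (gdef_gmul _ _ _)).
apply: (ec_and gdef_class); first by gdef_tac.
apply: (ec_and gdef_class (gdef_gmul _ _ _)).
by gdef_tac.
Qed.

(** Group numbers range over all integers; the naturals are recovered as the domain of n |-> 2^n,
    since [gpow2] excludes negative exponents. *)
Lemma gdef_nat : gdef (fun e => exists n : nat, e 0 = num n).
Proof.
have gy : gdef (fun e => exists y, gpow2 (e 0%N) y).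
  by apply: (ec_ex gdef_class); exact: (gdef_gpow2 1%N 0%N).
apply: (ec_ext gdef_class) gy => e; split=> [[y /gpow2P[k [-> _]]]|[k ->]]; first by exists k.
by exists (num (2 ^+ k)%R); apply/gpow2P; exists k.
Qed.

(** * Predicates on the naturals definable by systems *)

(** Q is unconstrained outside families of naturals, so quantifiers have to be relativized by
    [gdef_nat]. *)
Definition ndef (P : (nat -> nat) -> Prop) : Prop :=
  exists Q, gdef Q /\ forall v, P v <-> Q (fun i => num (v i)).

Lemma ndef_class : env_class ndef.
Proof.
split=> [P Q PQ [R [gR PR]]|r P [R [gR PR]]|P Q [R [gR PR]] [S [gS QS]]|P [R [gR PR]]].
- by exists R; split=> // v; rewrite -PQ.
- by exists (fun e => R (fun i => e (r i))); split=> [|v]; [apply: ec_ren gdef_class _ _ gR|].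
- exists (fun e => R e /\ S e); split; first exact: (ec_and gdef_class).
  by move=> v; rewrite PR QS.
exists (fun e => exists x, (exists n : nat, x = num n) /\ R (scons x e)); split.
  apply: (ec_ex gdef_class); apply: (ec_and gdef_class); first exact: gdef_nat.
  apply: (ec_ext gdef_class _ gR) => e.
  by have -> : scons (e 0%N) (fun i => e i.+1) = e by apply: functional_extensionality => -[].
have numS (n : nat) (v : nat -> nat) : scons (num n) (fun i => num (v i)) = (fun i => num (scons n v i)).
  by apply: functional_extensionality => -[].
move=> v; split=> [[n Pn]|[_ [[n ->]]]]; last first.
  by rewrite numS -PR => Pn; exists n.
by exists (num n); split; [exists n | rewrite numS -PR].
Qed.

Local Close Scope group_scope.

Lemma ndef_true : ndef (fun _ => True).
Proof.
exists (fun e => e 0 = e 0); split=> //.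
by apply: gdef_eq; exact: gfun_var.
Qed.

Lemma ndef_eq_var i j : ndef (fun v => v i = v j).
Proof.
exists (fun e => e i = e j); split; first by apply: gdef_eq; gfun_tac.
by move=> v; split=> [->|/num_inj[]].
Qed.

Lemma ndef_eq_const c : ndef (fun v => c = v 0).
Proof.
exists (fun e => num c = e 0); split; first by apply: gdef_eq; gfun_tac.
by move=> v; split=> [->|/num_inj[]].
Qed.

Lemma ndef_add : ndef (fun v => v 0 + v 1 = v 2).
Proof.
exists (fun e => e 0%N * e 1%N = e 2%N)%g; split; first by apply: gdef_eq; gfun_tac.
by move=> v; rewrite numM; split=> [<-|/num_inj[]] //; rewrite PoszD.
Qed.

Lemma ndef_mul : ndef (fun v => v 0 * v 1 = v 2).
Proof.
exists (fun e => gmul (e 0) (e 1) (e 2)); split; first exact: gdef_gmul.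
move=> v; rewrite gmulP; split=> [<-|[a [b [/num_inj<- /num_inj<- /num_inj]]]].
  by exists (v 0), (v 1); rewrite PoszM.
by rewrite -PoszM => -[].
Qed.

Lemma ndef_pow2 : ndef (fun v => 2 ^ v 0 = v 1).
Proof.
have e (k : nat) : (2 ^+ k)%R = Posz (2 ^ k) by rewrite -natrX natz.
exists (fun e => gpow2 (e 0) (e 1)); split; first exact: gdef_gpow2.
move=> v; rewrite gpow2P; split=> [<-|[k []]].
  by exists (v 0); rewrite e.
by rewrite e => /num_inj[<-] /num_inj[->].
Qed.

Section DefinableFunctions.

Variable C : ((nat -> nat) -> Prop) -> Prop.
Hypothesis HC : env_class C.

Definition cfun (F : (nat -> nat) -> nat) : Prop := C (fun e => F (fun i => e i.+1) = e 0).

Lemma cfun_ren r F : cfun F -> cfun (fun e => F (fun i => e (r i))).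
Proof. exact: (ec_ren HC (fun i => if i is k.+1 then (r k).+1 else 0)). Qed.

Lemma cfun_rel1 (R : nat -> Prop) F : C (fun e => R (e 0)) -> cfun F -> C (fun e => R (F e)).
Proof.
move=> CR CF; have ext e : (exists x, F e = x /\ R x) <-> R (F e).
  by split=> [[_ [<-]]|RF] //; exists (F e).
apply: (ec_ext HC ext); apply: (ec_ex HC); apply: (ec_and HC CF).
exact: (ec_ren HC (fun _ => 0) CR).
Qed.

Lemma cfun_rel2 (R : nat -> nat -> Prop) F G :
  C (fun e => R (e 0) (e 1)) -> cfun F -> cfun G -> C (fun e => R (F e) (G e)).
Proof.
move=> CR CF CG; have ext e : (exists x, G e = x /\ R (F e) x) <-> R (F e) (G e).
  by split=> [[_ [<-]]|RF] //; exists (G e).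
apply: (ec_ext HC ext); apply: (ec_ex HC); apply: (ec_and HC CG).
have ext' e : (exists x, F (fun i => e i.+1) = x /\ R x (e 0)) <-> R (F (fun i => e i.+1)) (e 0).
  by split=> [[_ [<-]]|RF] //; eexists.
apply: (ec_ext HC ext'); apply: (ec_ex HC); apply: (ec_and HC (cfun_ren _ CF)).
exact: (ec_ren HC (fun i => i) CR).
Qed.

Lemma cfun_rel3 (R : nat -> nat -> nat -> Prop) F G H :
  C (fun e => R (e 0) (e 1) (e 2)) -> cfun F -> cfun G -> cfun H ->
  C (fun e => R (F e) (G e) (H e)).
Proof.
move=> CR CF CG CH; have ext e : (exists x, H e = x /\ R (F e) (G e) x) <-> R (F e) (G e) (H e).
  by split=> [[_ [<-]]|RF] //; exists (H e).
apply: (ec_ext HC ext); apply: (ec_ex HC); apply: (ec_and HC CH).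
have ext' e : (exists x, G (fun i => e i.+1) = x /\ R (F (fun i => e i.+1)) x (e 0)) <->
    R (F (fun i => e i.+1)) (G (fun i => e i.+1)) (e 0).
  by split=> [[_ [<-]]|RF] //; eexists.
apply: (ec_ext HC ext'); apply: (ec_ex HC); apply: (ec_and HC (cfun_ren _ CG)).
have ext2 e : (exists x, F (fun i => e i.+2) = x /\ R x (e 0) (e 1)) <->
    R (F (fun i => e i.+2)) (e 0) (e 1).
  by split=> [[_ [<-]]|RF] //; eexists.
apply: (ec_ext HC ext2); apply: (ec_ex HC).
by apply: (ec_and HC (cfun_ren (fun i => i.+2) CF)); exact: (ec_ren HC (fun i => i) CR).
Qed.

Lemma cfun_comp1 (h : nat -> nat) F :
  C (fun e => h (e 0) = e 1) -> cfun F -> cfun (fun e => h (F e)).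
Proof.
move=> Ch CF; rewrite /cfun.
have ext e : (exists x, F (fun i => e i.+1) = x /\ h x = e 0) <-> h (F (fun i => e i.+1)) = e 0.
  by split=> [[_ [<-]]|RF] //; eexists.
apply: (ec_ext HC ext); apply: (ec_ex HC); apply: (ec_and HC (cfun_ren _ CF)).
exact: (ec_ren HC (fun i => i) Ch).
Qed.

Lemma cfun_comp2 (h : nat -> nat -> nat) F G :
  C (fun e => h (e 0) (e 1) = e 2) -> cfun F -> cfun G -> cfun (fun e => h (F e) (G e)).
Proof.
move=> Ch CF CG; rewrite /cfun.
have ext e : (exists x, F (fun i => e i.+1) = x /\ exists y, G (fun i => e i.+1) = y /\ h x y = e 0)
    <-> h (F (fun i => e i.+1)) (G (fun i => e i.+1)) = e 0.
  by split=> [[_ [<- [_ [<-]]]]|RF] //; exists (F (fun i => e i.+1)); split=> //; eexists.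
apply: (ec_ext HC ext); apply: (ec_ex HC); apply: (ec_and HC (cfun_ren _ CF)).
apply: (ec_ex HC); apply: (ec_and HC (cfun_ren (fun i => i.+2) CG)).
exact: (ec_ren HC (fun i => if i is k.+1 then if k is l.+1 then l.+2 else 0 else 1) Ch).
Qed.

End DefinableFunctions.

(** Order, divisibility and congruence are derived from these atoms once for [ndef], [dio] and
    [cdef]. *)
Record arith_class (C : ((nat -> nat) -> Prop) -> Prop) : Prop := ArithClass {
  ac_env : env_class C;
  ac_eq : C (fun e => e 0 = e 1);
  ac_const : forall c, C (fun e => c = e 0);
  ac_add : C (fun e => e 0 + e 1 = e 2);
  ac_mul : C (fun e => e 0 * e 1 = e 2)
}.

Section ArithClassTheory.

Variable C : ((nat -> nat) -> Prop) -> Prop.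
Hypothesis AC : arith_class C.
Let HC := ac_env AC.

Lemma cfunV i : cfun C (fun e => e i).
Proof. exact: (ec_ren HC (fun k => if k is 0 then i.+1 else 0) (ac_eq AC)). Qed.

Lemma cfunC c : cfun C (fun _ => c). Proof. exact: ac_const. Qed.

Lemma cfunD F G : cfun C F -> cfun C G -> cfun C (fun e => F e + G e).
Proof. exact: (cfun_comp2 HC (ac_add AC)). Qed.

Lemma cfunM F G : cfun C F -> cfun C G -> cfun C (fun e => F e * G e).
Proof. exact: (cfun_comp2 HC (ac_mul AC)). Qed.

Lemma cfunS F : cfun C F -> cfun C (fun e => (F e).+1).
Proof.
move=> CF; apply: (ec_ext HC _ (cfunD CF (cfunC 1))) => e.
by rewrite addn1.
Qed.

Lemma crel_eq F G : cfun C F -> cfun C G -> C (fun e => F e = G e).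
Proof. exact: (cfun_rel2 HC (ac_eq AC)). Qed.

Lemma crel_le F G : cfun C F -> cfun C G -> C (fun e => F e <= G e).
Proof.
apply: (@cfun_rel2 _ HC (fun x y => is_true (x <= y))).
have ext e : (exists z, e 0 + z = e 1) <-> e 0 <= e 1.
  by split=> [[z <-]|le]; [exact: leq_addr | exists (e 1 - e 0); rewrite subnKC].
apply: (ec_ext HC ext); apply: (ec_ex HC).
by apply: crel_eq (cfunD (cfunV _) (cfunV _)) (cfunV _).
Qed.

Lemma crel_dvd F G : cfun C F -> cfun C G -> C (fun e => F e %| G e).
Proof.
apply: (@cfun_rel2 _ HC (fun x y => is_true (x %| y))).
have ext e : (exists z, e 1 = z * e 0) <-> e 0 %| e 1.
  by split=> /dvdnP.
apply: (ec_ext HC ext); apply: (ec_ex HC).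
by apply: crel_eq (cfunV _) (cfunM (cfunV _) (cfunV _)).
Qed.

Lemma crel_eqmod F G H : cfun C F -> cfun C G -> cfun C H ->
  C (fun e => F e = G e %[mod H e]).
Proof.
apply: (@cfun_rel3 _ HC (fun x y z => x = y %[mod z])).
have ext e : (exists x y, e 0 + x * e 2 = e 1 + y * e 2) <-> e 0 = e 1 %[mod e 2].
  split=> [[x [y exy]]|e01].
    by rewrite -(modnMDl x) -[RHS](modnMDl y) addnC exy addnC.
  exists (e 1 %/ e 2), (e 0 %/ e 2).
  by rewrite {1}(divn_eq (e 0) (e 2)) {2}(divn_eq (e 1) (e 2)) e01; lia.
apply: (ec_ext HC ext); do 2 apply: (ec_ex HC).
by apply: crel_eq (cfunD (cfunV _) (cfunM (cfunV _) (cfunV _)))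
                  (cfunD (cfunV _) (cfunM (cfunV _) (cfunV _))).
Qed.

End ArithClassTheory.

Ltac arith_step AC :=
  lazymatch goal with
  | |- cfun _ (fun e => @?f e + @?g e) => refine (@cfunD _ AC f g _ _)
  | |- cfun _ (fun e => @?f e * @?g e) => refine (@cfunM _ AC f g _ _)
  | |- cfun _ (fun e => (@?f e).+1) => refine (@cfunS _ AC f _)
  | |- cfun _ (fun e => e ?i) => exact (cfunV AC i)
  | |- cfun _ (fun e => ?c) => exact (cfunC AC c)
  | |- _ (fun e => exists x, _) => apply: (ec_ex (ac_env AC))
  | |- _ (fun e => _ /\ _) => apply: (ec_and (ac_env AC))
  | |- _ (fun e => @?f e %% @?h e = @?g e %% @?h e) => refine (@crel_eqmod _ AC f g h _ _ _)
  | |- _ (fun e => @?f e = @?g e) => refine (@crel_eq _ AC f g _ _)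
  | |- _ (fun e => is_true (@?f e <= @?g e)) => refine (@crel_le _ AC f g _ _)
  | |- _ (fun e => is_true (@?f e %| @?g e)) => refine (@crel_dvd _ AC f g _ _)
  end.

Ltac arith_tac AC := repeat first [assumption | progress cbv beta | arith_step AC].

(** * Powers, binomial coefficients and factorials *)

Lemma ndef_arith : arith_class ndef.
Proof.
split; [exact: ndef_class | exact: ndef_eq_var | exact: ndef_eq_const
  | exact: ndef_add | exact: ndef_mul].
Qed.

Lemma nfun_pow2 F : cfun ndef F -> cfun ndef (fun e => 2 ^ F e).
Proof. exact: (cfun_comp1 ndef_class ndef_pow2). Qed.

Ltac ndef_tac := repeat first
  [ assumption | progress cbv beta
  | lazymatch goal with
    | |- cfun ndef (fun e => 2 ^ @?f e) => refine (@nfun_pow2 f _)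
    end
  | arith_step ndef_arith ].

(* 2^b = a modulo 2^b - a, hence a^n is the remainder of 2^(b n). *)
Lemma exp_by_pow2 a n r : a ^ n = r <->
  exists m q, m + a = 2 ^ (a * n + a).+1 /\ r < m /\ 2 ^ ((a * n + a).+1 * n) = q * m + r.
Proof.
set b := (a * n + a).+1.
(* The exponent b = a n + a + 1 makes a^n smaller than the modulus 2^b - a, so the remainder is a^n
   itself. *)
have lt_an : a ^ n + a < 2 ^ b.
  have a2 : a < 2 ^ a by rewrite ltn_expl.
  have an2 : a ^ n <= 2 ^ (a * n).
    by rewrite expnM; case: (n) => // k; rewrite leq_exp2r // ltnW.
  have : 0 < 2 ^ (a * n) by rewrite expn_gt0.
  rewrite /b expnS expnD; move: (2 ^ (a * n)) (2 ^ a) (a ^ n) a2 an2 => x y z; nia.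
have mE : 2 ^ b - a + a = 2 ^ b by rewrite subnK // (leq_trans (leq_addl _ _) (ltnW lt_an)).
have pm m : m + a = 2 ^ b -> 2 ^ (b * n) = a ^ n %[mod m].
  by move=> em; rewrite expnM -em -modnXm modnDl modnXm.
split=> [<-|[m [q [em [rm eq]]]]].
  exists (2 ^ b - a), (2 ^ (b * n) %/ (2 ^ b - a)); split=> //; split; first by lia.
  by rewrite {1}(divn_eq (2 ^ (b * n)) (2 ^ b - a)) (pm _ mE) (@modn_small (a ^ n)) //; lia.
have := pm m em; rewrite eq modnMDl (modn_small rm) modn_small //; lia.
Qed.

Lemma nfun_exp F G : cfun ndef F -> cfun ndef G -> cfun ndef (fun e => F e ^ G e).
Proof.
apply: (cfun_comp2 ndef_class).
apply: (ec_ext ndef_class (fun e => iff_sym (exp_by_pow2 (e 0) (e 1) (e 2)))).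
by ndef_tac.
Qed.

Lemma sum_digit B k m (f : nat -> nat) : (forall i, f i < B) -> k < m ->
  exists l h, \sum_(i < m) f i * B ^ i = l + B ^ k * (f k + B * h) /\ l < B ^ k.
Proof.
move=> fB; elim: k m f fB => [|k IH] [|m] f fB // km; rewrite big_ord_recl /= expn0 muln1.
  exists 0, (\sum_(i < m) f i.+1 * B ^ i); split=> //.
  rewrite mul1n add0n big_distrr /=; congr (_ + _); apply: eq_bigr => i _.
  by rewrite /bump /= add1n expnS mulnCA.
have [l [h [e lB]]] := IH m (fun i => f i.+1) (fun i => fB i.+1) km.
exists (f 0 + B * l), h; split.
  have -> : \sum_(i < m) f (bump 0 i) * B ^ bump 0 i = B * \sum_(i < m) f i.+1 * B ^ i.
    by rewrite big_distrr /=; apply: eq_bigr => i _; rewrite /bump /= add1n expnS mulnCA.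
  by rewrite e mulnDr expnS addnA mulnA.
have : B * l.+1 <= B * B ^ k by rewrite leq_mul2l lB orbT.
by rewrite mulnS expnS; apply: leq_trans; rewrite ltn_add2r.
Qed.

(** Since C(n, k) <= 2^n < B = 2^(n+1), the binomial coefficients are the digits of (B + 1)^n in
    base B. *)
Lemma binomial_digit n k c : 'C(n, k) = c <->
  exists l h, (2 ^ n.+1).+1 ^ n = l + (2 ^ n.+1) ^ k * (c + 2 ^ n.+1 * h) /\
    l < (2 ^ n.+1) ^ k /\ c < 2 ^ n.+1.
Proof.
set B := 2 ^ n.+1.
have CB i : 'C(n, i) < B.
  rewrite /B expnS mul2n -addnn.
  have : 'C(n, i) <= 2 ^ n.
    have [ni|ni] := ltnP n i; first by rewrite bin_small.
    rewrite -[2]/(1 + 1) expnDn (bigD1 (Ordinal (ni : i < n.+1))) //=.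
    by rewrite !exp1n !muln1 leq_addr.
  have : 0 < 2 ^ n by rewrite expn_gt0.
  by lia.
(* Summing beyond n keeps position k in range even for k > n, where the digit is 0. *)
have [l [h [e lB]]] := sum_digit CB (leq_addl n.+1 k.+1 : k < n.+1 + k.+1).
have {}e : B.+1 ^ n = l + B ^ k * ('C(n, k) + B * h).
  rewrite -e -add1n expnDn big_split_ord /= [X in _ + X]big1 ?addn0 => [|i _]; last first.
    by rewrite bin_small // addSn ltnS leq_addr.
  by apply: eq_bigr => i _; rewrite exp1n mul1n.
split=> [<-|[l' [h' [e' [lB' cB]]]]]; first by exists l, h.
have Bk : 0 < B ^ k by rewrite !expn_gt0.
have dig x y z : x < B ^ k -> y < B -> (x + B ^ k * (y + B * z)) %/ B ^ k %% B = y.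
  move=> xB yB; rewrite addnC mulnC divnMDl // (divn_small xB) addn0.
  by rewrite addnC mulnC modnMDl modn_small.
by rewrite -(dig l 'C(n, k) h) // -e e' dig.
Qed.

Ltac ndef_tac ::= repeat first
  [ assumption | progress cbv beta
  | lazymatch goal with
    | |- cfun ndef (fun e => @?f e ^ @?g e) => refine (@nfun_exp f g _ _)
    end
  | arith_step ndef_arith ].

Lemma nfun_bin F G : cfun ndef F -> cfun ndef G -> cfun ndef (fun e => 'C(F e, G e)).
Proof.
apply: (cfun_comp2 ndef_class).
apply: (ec_ext ndef_class (fun e => iff_sym (binomial_digit (e 0) (e 1) (e 2)))).
by ndef_tac.
Qed.

Ltac ndef_tac ::= repeat first
  [ assumption | progress cbv beta
  | lazymatch goal with
    | |- cfun ndef (fun e => @?f e ^ @?g e) => refine (@nfun_exp f g _ _)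
    | |- cfun ndef (fun e => 'C(@?f e, @?g e)) => refine (@nfun_bin f g _ _)
    end
  | arith_step ndef_arith ].

Lemma ffact_le_exp r w : r ^_ w <= r ^ w.
Proof.
elim: w => [|w IH]; first by rewrite ffactn0.
by rewrite ffactnSr expnSr leq_mul // leq_subr.
Qed.

(** Replacing a factor r by r - i with i < w costs at most w r^(w-1), and there are w factors. *)
Lemma exp_le_ffact r w : w <= r -> r ^ w <= r ^_ w + w * w * r ^ w.-1.
Proof.
elim: w => [|w IH] wr; first by rewrite ffactn0.
have := IH (ltnW wr); have := ffact_le_exp r w.
rewrite ffactnSr expnSr /=; have [d ->] : exists d, r = w + d by exists (r - w); rewrite subnKC // ltnW.
rewrite addKn; case: w {IH wr} => [|w]; first by rewrite ffactn0 !expn0 add0n; lia.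
rewrite /= expnS; move: ((w.+1 + d) ^_ w.+1) ((w.+1 + d) ^ w) => x y; nia.
Qed.

(** w! C(r, w) is the falling factorial of r, which is close to r^w for large r; hence w! is the
    integer part of r^w / C(r, w). *)
Lemma fact_div_bin w F : w`! = F <->
  exists r, r = w.+1 ^ (w + 3) /\ F * 'C(r, w) <= r ^ w /\ r ^ w < F.+1 * 'C(r, w).
Proof.
set r := w.+1 ^ (w + 3).
(* The exponent w + 3 comes from w! + 1 <= 2 (w + 1)^w and 2 w^2 < (w + 1)^3. *)
have r_big : (w`!).+1 * (w * w) < r.
  have w1 : w ^ w <= w.+1 ^ w by case: (w) => // k; rewrite leq_exp2r.
  have := ffact_le_exp w w; rewrite ffactnn /r expnD.
  have : 0 < w.+1 ^ w by rewrite expn_gt0.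
  move: (w`!) (w ^ w) (w.+1 ^ w) w1 => f x y w1 y0 fx; rewrite !expnS expn0 muln1.
  have : f.+1 <= y.*2 by lia.
  move=> fy; apply: (@leq_ltn_trans (y.*2 * (w * w))); first by rewrite leq_mul2r fy orbT.
  by rewrite -muln2 -mulnA ltn_mul2l y0 /=; nia.
have wr : w <= r.
  by have := fact_gt0 w; move: (w`!) r_big => f; clear; nia.
have h1 : w`! * 'C(r, w) <= r ^ w by rewrite mulnC bin_ffact ffact_le_exp.
have h2 : r ^ w < (w`!).+1 * 'C(r, w).
  rewrite -(ltn_pmul2l (fact_gt0 w)) mulnCA [_`! * 'C(_, _)]mulnC bin_ffact.
  have := exp_le_ffact wr; have := fact_gt0 w.
  case: (posnP w) => [->|w0]; first by rewrite !expn0 ffactn0.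
  have : (w`!).+1 * (w * w) * r ^ w.-1 < r * r ^ w.-1.
    by rewrite ltn_pmul2r // expn_gt0; lia.
  rewrite -expnS prednK //; move: (r ^ w) (r ^_ w) (r ^ w.-1) (w`!) (w * w); nia.
split=> [<-|[_ [-> [h3 h4]]]]; first by exists r.
have C0 : 0 < 'C(r, w) by rewrite bin_gt0.
have : w`! < F.+1 by rewrite -(ltn_pmul2r C0) (leq_ltn_trans h1 h4).
have : F < (w`!).+1 by rewrite -(ltn_pmul2r C0) (leq_ltn_trans h3 h2).
lia.
Qed.

Lemma nfun_fact F : cfun ndef F -> cfun ndef (fun e => (F e)`!).
Proof.
apply: (cfun_comp1 ndef_class).
apply: (ec_ext ndef_class (fun e => iff_sym (fact_div_bin (e 0) (e 1)))).
by ndef_tac.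
Qed.

(** * Chinese remainders and binomial moduli *)

Lemma coprime_prodl n (q : nat -> nat) x :
  (forall i, i < n -> coprime (q i) x) -> coprime (\prod_(i < n) q i) x.
Proof.
elim: n => [|n IH] qx; first by rewrite big_ord0 coprime1n.
by rewrite big_ord_recr coprimeMl IH ?qx // => i ni; apply/qx/ltnW.
Qed.

Definition pairwise_coprime n (q : nat -> nat) : Prop :=
  forall i j, i < n -> j < n -> i != j -> coprime (q i) (q j).

Lemma pairwise_coprime_prod n q :
  pairwise_coprime n.+1 q -> coprime (\prod_(i < n) q i) (q n).
Proof.
by move=> qq; apply: coprime_prodl => i ni; apply: qq => //; [apply: ltnW | rewrite ltn_eqF].
Qed.

Lemma pairwise_coprimeS n q : pairwise_coprime n.+1 q -> pairwise_coprime n q.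
Proof. by move=> qq i j ni nj; apply: qq; apply: ltnW. Qed.

Lemma chinese_family n q (r : nat -> nat) : pairwise_coprime n q ->
  exists a, forall i, i < n -> a = r i %[mod q i].
Proof.
elim: n => [|n IH] qq; first by exists 0.
have [a ha] := IH (pairwise_coprimeS qq).
have cop := pairwise_coprime_prod qq.
exists (chinese (\prod_(i < n) q i) (q n) a (r n)) => i; rewrite ltnS leq_eqVlt.
case: eqP => [-> _|_ /= ni]; first exact: chinese_modr.
have qd : q i %| \prod_(j < n) q j by rewrite (bigD1 (Ordinal ni)) //= dvdn_mulr.
by rewrite -(modn_dvdm _ qd) chinese_modl // modn_dvdm // ha.
Qed.

Lemma prod_coprime_dvd n q x : pairwise_coprime n q ->
  (forall i, i < n -> q i %| x) -> \prod_(i < n) q i %| x.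
Proof.
elim: n => [|n IH] qq qx; first by rewrite big_ord0 dvd1n.
rewrite big_ord_recr /= Gauss_dvd ?pairwise_coprime_prod // qx // IH //.
  exact: pairwise_coprimeS.
by move=> i ni; apply/qx/ltnW.
Qed.

Lemma prod_coprime_eqmod n q x y : pairwise_coprime n q ->
  (forall i, i < n -> x = y %[mod q i]) -> x = y %[mod \prod_(i < n) q i].
Proof.
move=> qq; wlog le_yx : x y / y <= x => [H xy|xy].
  by case: (leqP y x) => [/H|/ltnW/H h]; [exact | apply/esym/h => i /xy].
apply/eqP; rewrite eqn_mod_dvd //; apply: prod_coprime_dvd => // i ni.
by rewrite -eqn_mod_dvd //; apply/eqP/xy.
Qed.

(** The factor a - y of a (a - 1) ... (a - u) is a multiple of q, and the product is 0 if a <= u. A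
    bound u on a residue thus becomes a divisibility; for the converse [prime_dvd_ffact], a prime
    dividing the product divides one factor. *)
Lemma dvd_ffact_of_eqmod q a y u : y <= u -> a = y %[mod q] -> q %| a ^_ u.+1.
Proof.
move=> yu ay; have [au|ua] := leqP a u; first by rewrite ffact_small.
rewrite ffact_prod (bigD1 (Ordinal (yu : y < u.+1))) //= dvdn_mulr //.
by rewrite -eqn_mod_dvd ?ay // (leq_trans yu (ltnW ua)).
Qed.

Lemma prime_dvd_ffact p a u : prime p -> u < p -> p %| a ^_ u.+1 -> a %% p <= u.
Proof.
move=> pp up; have [au _|ua] := leqP a u; first by rewrite (leq_trans (leq_mod _ _)).
rewrite ffact_prod Euclid_dvd_prod // big_orE => /existsP[i /=]; have := ltn_ord i; rewrite ltnS => iu.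
rewrite -eqn_mod_dvd => [/eqP->|]; first by rewrite (leq_trans (leq_mod _ _)).
exact: leq_trans iu (ltnW ua).
Qed.

(* C(Z, n) for Z = W!^2 - 1 is the product of the pairwise coprime moduli
   W!^2/i - 1 for 0 < i <= n, whose prime factors all exceed W, and
   Z = i - 1 modulo W!^2/i - 1: this replaces the moduli 1 + i t of Goedel's
   beta function. *)
Section BinomialModuli.

Variable W Z : nat.
Hypothesis W3 : 3 <= W.
Hypothesis ZE : Z.+1 = W`! * W`!.

Definition bmod (i : nat) : nat := (Z.+1 %/ i.+1).-1.

Lemma fact_div_gt0 i : i < W -> 0 < W`! %/ i.+1.
Proof. by move=> iW; rewrite divn_gt0 // dvdn_leq ?fact_gt0 // dvdn_fact. Qed.

(** The reason for squaring W!: after division by i + 1 a factor W! remains. Every prime up to W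
    divides it, and so cannot divide [bmod i]. *)
Lemma bmodS i : i < W -> (bmod i).+1 = W`! * (W`! %/ i.+1).
Proof.
move=> iW; rewrite /bmod ZE -muln_divA ?dvdn_fact // prednK //.
by rewrite muln_gt0 fact_gt0 fact_div_gt0.
Qed.

Lemma bmodK i : i < W -> i.+1 * (bmod i).+1 = Z.+1.
Proof. by move=> iW; rewrite bmodS // mulnCA [i.+1 * _]mulnC divnK ?dvdn_fact. Qed.

Lemma bmod_eqmod i : i < W -> Z = i %[mod bmod i].
Proof.
move=> iW; have /eqP := bmodK iW; rewrite mulnS addSn eqSS => /eqP <-.
by rewrite addnC modnMDl.
Qed.

Lemma bmod_prime i p : i < W -> prime p -> p %| bmod i -> W < p.
Proof.
move=> iW pp pq; rewrite ltnNge; apply/negP => pW.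
have : p %| (bmod i).+1 by rewrite bmodS // dvdn_mulr // dvdn_fact // prime_gt0.
by rewrite -addn1 dvdn_addr // dvdn1 => /eqP p1; rewrite p1 in pp.
Qed.

Lemma bmod_gt1 i : i < W -> 1 < bmod i.
Proof.
move=> iW; have WW : W <= W`! by rewrite dvdn_leq ?fact_gt0 // dvdn_fact // (leq_trans _ W3) /=.
by rewrite -ltnS bmodS // (leq_trans W3) // (leq_trans WW) // leq_pmulr // fact_div_gt0.
Qed.

(** A common prime p would give i = Z = j modulo p, although i, j < W < p. *)
Lemma bmod_coprime n : n <= W -> pairwise_coprime n bmod.
Proof.
move=> nW i j iN jN ij; have iW := leq_trans iN nW; have jW := leq_trans jN nW.
apply/negPn/negP => ncop; set g := gcdn (bmod i) (bmod j) in ncop.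
have g1 : 1 < g.
  have : 0 < g by rewrite gcdn_gt0 (ltnW (bmod_gt1 iW)).
  by rewrite leq_eqVlt => /orP[/eqP e|//]; rewrite /coprime -/g -e in ncop.
have pp := pdiv_prime g1; set p := pdiv g in pp.
have pi : p %| bmod i := dvdn_trans (pdiv_dvd g) (dvdn_gcdl _ _).
have pj : p %| bmod j := dvdn_trans (pdiv_dvd g) (dvdn_gcdr _ _).
have Wp := bmod_prime iW pp pi.
have : i = j %[mod p].
  by rewrite -(modn_dvdm i pi) -(modn_dvdm j pj) -(bmod_eqmod iW) -(bmod_eqmod jW) !modn_dvdm.
by rewrite !modn_small ?(ltn_trans _ Wp) // => /eqP; rewrite (negPf ij).
Qed.

(** From (n + 1) C(Z, n + 1) = (Z - n) C(Z, n), where Z - n = (n + 1) [bmod n]. *)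
Lemma bmod_prod n : n <= W -> \prod_(i < n) bmod i = 'C(Z, n).
Proof.
elim: n => [|n IH] nW; first by rewrite big_ord0 bin0.
rewrite big_ord_recr /= IH ?(ltnW nW) //; apply/eqP.
rewrite -(eqn_pmul2l (ltn0Sn n)) mul_bin_left mulnCA mulnC; apply/eqP; congr (_ * _).
have := bmodK nW; rewrite mulnS; lia.
Qed.

End BinomialModuli.

(** * Polynomial equations over the naturals *)

Inductive pexp : Type :=
  | PVar of nat
  | PConst of nat
  | PAdd of pexp & pexp
  | PMul of pexp & pexp.

Fixpoint peval (e : nat -> nat) (p : pexp) : nat :=
  match p with
  | PVar i => e i
  | PConst c => c
  | PAdd p1 p2 => peval e p1 + peval e p2
  | PMul p1 p2 => peval e p1 * peval e p2
  end.

Fixpoint pren (r : nat -> nat) (p : pexp) : pexp :=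
  match p with
  | PVar i => PVar (r i)
  | PConst c => PConst c
  | PAdd p1 p2 => PAdd (pren r p1) (pren r p2)
  | PMul p1 p2 => PMul (pren r p1) (pren r p2)
  end.

Fixpoint pbound (p : pexp) : nat :=
  match p with
  | PVar i => i.+1
  | PConst c => 0
  | PAdd p1 p2 | PMul p1 p2 => pbound p1 + pbound p2
  end.

Lemma peval_pren r e p : peval e (pren r p) = peval (fun i => e (r i)) p.
Proof. by elim: p => //= p1 -> p2 ->. Qed.

Lemma peval_eqmod m e e' p : (forall i, i < pbound p -> e i = e' i %[mod m]) ->
  peval e p = peval e' p %[mod m].
Proof.
elim: p => //= [i|p1 IH1 p2 IH2|p1 IH1 p2 IH2] ee; first exact: ee.
  by rewrite -modnDm IH1 1?IH2 ?modnDm // => i ip; apply: ee; lia.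
by rewrite -modnMm IH1 1?IH2 ?modnMm // => i ip; apply: ee; lia.
Qed.

Lemma peval_local e e' p : (forall i, i < pbound p -> e i = e' i) -> peval e p = peval e' p.
Proof.
(* Congruence modulo 0 is equality. *)
by move=> ee; have := @peval_eqmod 0 e e' p; rewrite !modn0; apply=> i /ee ->.
Qed.

Lemma peval_le e u p : (forall i, i < pbound p -> e i <= u) ->
  peval e p <= peval (fun _ => u) p.
Proof.
elim: p => //= [i|p1 IH1 p2 IH2|p1 IH1 p2 IH2] ee; first exact: ee.
  by apply: leq_add; [apply: IH1 | apply: IH2] => i ip; apply: ee; lia.
by apply: leq_mul; [apply: IH1 | apply: IH2] => i ip; apply: ee; lia.
Qed.

Lemma cfun_peval C (AC : arith_class C) (F : nat -> (nat -> nat) -> nat) p :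
  (forall i, cfun C (F i)) -> cfun C (fun e => peval (fun i => F i e) p).
Proof.
by move=> CF; elim: p => /= [i|c|p1 IH1 p2 IH2|p1 IH1 p2 IH2] //; arith_tac AC.
Qed.

Definition psat (e : nat -> nat) (pq : pexp * pexp) : bool :=
  peval e pq.1 == peval e pq.2.

Definition eqren (r : nat -> nat) (pq : pexp * pexp) := (pren r pq.1, pren r pq.2).

Lemma psat_ren r e pq : psat e (eqren r pq) = psat (fun i => e (r i)) pq.
Proof. by rewrite /psat !peval_pren. Qed.

Definition dio : ((nat -> nat) -> Prop) -> Prop := edef psat.

Lemma dio_class : env_class dio.
Proof. exact: edef_env_class psat_ren. Qed.

Lemma dio_sat p q : dio (fun e => peval e p = peval e q).
Proof.
by apply: (ec_ext dio_class) (edef_sat psat_ren (p, q)) => e; split=> /eqP.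
Qed.

Lemma dio_arith : arith_class dio.
Proof.
split; first exact: dio_class.
- exact: (dio_sat (PVar 0) (PVar 1)).
- by move=> c; exact: (dio_sat (PConst c) (PVar 0)).
- exact: (dio_sat (PAdd (PVar 0) (PVar 1)) (PVar 2)).
exact: (dio_sat (PMul (PVar 0) (PVar 1)) (PVar 2)).
Qed.

(** Multiplying every equation by variable 0 makes the system hold when that variable vanishes. This
    limited disjunction is what [cdef_lt_imp] is built on. *)
Lemma dio_zero_or P : dio P -> dio (fun e => e 0 = 0 \/ P (fun i => e i.+1)).
Proof.
move=> [s sP].
pose r i := if odd i then i else i.+2.
have jr e w : (fun i => join e w (r i)) = join (fun i => e i.+1) w.
  apply: functional_extensionality => i; rewrite /r {2}/join.
  by case: ifP => oi; rewrite /join /= ?negbK oi.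
exists [seq (PMul (PVar 0) (pren r pq.1), PMul (PVar 0) (pren r pq.2)) | pq <- s] => e.
have satE w : all (psat (join e w)) [seq (PMul (PVar 0) (pren r pq.1), PMul (PVar 0) (pren r pq.2)) | pq <- s]
    = (e 0 == 0) || all (psat (join (fun i => e i.+1) w)) s.
  rewrite all_map; elim: s {sP} => [|pq s IH]; first by rewrite orbT.
  rewrite /= {}IH /psat /= !peval_pren jr eqn_mul2l /join /=.
  by case: (e 0 == 0).
rewrite sP; split=> [[e0|[w h]]|[w]].
- by exists e; rewrite satE e0.
- by exists w; rewrite satE h orbT.
by rewrite satE => /orP[/eqP|h]; [left | right; exists w].
Qed.

Lemma finite_choice (T : Type) (x0 : T) n (R : nat -> T -> Prop) :
  (forall i, i < n -> exists x, R i x) -> exists f, forall i, i < n -> R i (f i).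
Proof.
elim: n => [|n IH] h; first by exists (fun _ => x0).
have [f hf] := IH (fun i ni => h i (ltnW ni)); have [x hx] := h n (ltnSn n).
exists (fun i => if i == n then x else f i) => i; rewrite ltnS leq_eqVlt.
by case: eqP => [-> //|_ /=]; exact: hf.
Qed.

Lemma half_le i : i./2 <= i.
Proof. by rewrite -[leqRHS]half_double half_leq // -addnn leq_addr. Qed.

Lemma leq_sum_ord n (f : nat -> nat) i : i < n -> f i <= \sum_(j < n) f j.
Proof. by move=> ni; rewrite (bigD1 (Ordinal ni)) //= leq_addr. Qed.

(** * Elimination of a bounded universal quantifier *)

Section BoundedForall.

Variable s : seq (pexp * pexp).

(** One polynomial dominating both sides of every equation, in the variables that occur and in
    value. *)
Definition psum : pexp := foldr (fun pq u => PAdd (PAdd pq.1 pq.2) u) (PConst 0) s.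

Definition eqn_ (k : nat) : pexp * pexp := nth (PConst 0, PConst 0) s k.

Lemma psum_bound k : k < size s ->
  pbound (eqn_ k).1 <= pbound psum /\ pbound (eqn_ k).2 <= pbound psum.
Proof.
rewrite /eqn_ /psum; elim: s k => // pq t IH [|k] /= ks; first by lia.
by have := IH k ks; lia.
Qed.

Lemma psum_peval e k : k < size s ->
  peval e (eqn_ k).1 <= peval e psum /\ peval e (eqn_ k).2 <= peval e psum.
Proof.
rewrite /eqn_ /psum; elim: s k => // pq t IH [|k] /= ks; first by lia.
by have := IH k ks; lia.
Qed.

Lemma all_psatP E : all (psat E) s <->
  forall k, k < size s -> peval E (eqn_ k).1 = peval E (eqn_ k).2.
Proof.
split=> [/(all_nthP (PConst 0, PConst 0)) h k ks|h]; first exact/eqP/h.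
by apply/(all_nthP (PConst 0, PConst 0)) => k ks; apply/eqP/h.
Qed.

(** The i-th unknown for a given k is coded as a residue of a i, modulo [bmod Z k]; M is the product
    of these moduli for k <= e 0. As Z = k modulo [bmod Z k], Z stands for the bound variable.
    Divisibility of the falling factorial C(a i, u + 1) (u + 1)! by M encodes the bound u on
    residues, and W exceeds both sides of each equation at arguments up to u. The [iota] ranges do
    not depend on e, so they are finite conjunctions. *)
Definition bounded_forall_witness (e : nat -> nat) (u W Z : nat) (a : nat -> nat) : Prop :=
  let K := pbound psum in let M := 'C(Z, (e 0).+1) in
  e 0 <= u /\ (forall i, i \in iota 0 K -> e i <= u) /\
  W = u + peval (fun _ => u) psum + 3 /\ Z.+1 = W`! * W`! /\
  (forall i, i \in iota 0 K -> M %| 'C(a i, u.+1) * (u.+1)`!) /\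
  forall k, k \in iota 0 (size s) ->
    peval (join (scons Z e) a) (eqn_ k).1 = peval (join (scons Z e) a) (eqn_ k).2 %[mod M].

(** Reduce modulo a prime p dividing [bmod Z k]. The residues of the a i are then at most u, so both
    sides of an equation stay below W < p and, being congruent, are equal. *)
Lemma bounded_forall_sound e u W Z a : bounded_forall_witness e u W Z a ->
  forall k, k <= e 0 -> exists w, all (psat (join (scons k e) w)) s.
Proof.
rewrite /bounded_forall_witness /=; set M := 'C(_, _); set K := pbound psum.
move=> [nu [eu [WE [ZE [aM sM]]]]] k kn.
have W3 : 3 <= W by lia.
have kW : k < W by lia.
pose p := pdiv (bmod Z k).
have pp : prime p by rewrite pdiv_prime // (bmod_gt1 W3 ZE).
have pq : p %| bmod Z k by exact: pdiv_dvd.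
have Wp : W < p by exact: (bmod_prime ZE kW pp pq).
have pM : p %| M.
  rewrite /M -(bmod_prod W3 ZE); last by lia.
  by rewrite (bigD1 (Ordinal (kn : k < (e 0).+1))) //= dvdn_mulr.
have Zk : Z = k %[mod p] by rewrite -(modn_dvdm Z pq) (bmod_eqmod ZE kW) modn_dvdm.
pose w i := a i %% p; exists w; apply/all_psatP => l ls.
have [b1 b2] := psum_bound ls; have [v1 v2] := psum_peval (fun _ => u) ls.
have wu i : i < K -> w i <= u.
  move=> iK; apply: prime_dvd_ffact => //; first by lia.
  by rewrite -bin_ffact (dvdn_trans pM) // aM // mem_iota.
have Eu i : i < K -> join (scons k e) w i <= u.
  move=> iK; have := leq_ltn_trans (half_le i) iK; rewrite /join.
  case: ifP => _; first exact: wu.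
  case: (i./2) => [|j] /= hj; first exact: leq_trans kn nu.
  by apply: eu; rewrite mem_iota /= ltnW.
have EZ i : join (scons k e) w i = join (scons Z e) a i %[mod p].
  rewrite /join; case: ifP => _; first by rewrite modn_mod.
  by case: (i./2).
have small r : pbound r <= K -> peval (fun _ => u) r <= peval (fun _ => u) psum ->
    peval (join (scons k e) w) r < p.
  move=> rK ru; apply: leq_ltn_trans Wp; rewrite WE.
  have : peval (join (scons k e) w) r <= peval (fun _ => u) r.
    by apply: peval_le => i ir; apply: Eu; exact: leq_trans ir rK.
  move=> le; have := leq_trans le ru; move: (peval _ r) (peval _ psum) => x y; clear; lia.
rewrite -(modn_small (small _ b1 v1)) -[RHS](modn_small (small _ b2 v2)).
rewrite (peval_eqmod (fun i _ => EZ i)) [RHS](peval_eqmod (fun i _ => EZ i)).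
by rewrite -(modn_dvdm _ pM) sM ?mem_iota // modn_dvdm.
Qed.

Lemma bounded_forall_complete e :
    (forall k, k <= e 0 -> exists w, all (psat (join (scons k e) w)) s) ->
  exists u W Z a, bounded_forall_witness e u W Z a.
Proof.
move=> H; have [w sw] := @finite_choice _ e (e 0).+1 _ H; set K := pbound psum.
pose u := e 0 + \sum_(i < K) e i + \sum_(k < (e 0).+1) \sum_(i < K) w k i.
pose W := u + peval (fun _ => u) psum + 3; pose Z := (W`! * W`!).-1.
have W3 : 3 <= W by rewrite /W; lia.
have ZE : Z.+1 = W`! * W`! by rewrite prednK // muln_gt0 fact_gt0.
have nu : e 0 <= u by rewrite /u; lia.
have nW : (e 0).+1 <= W by rewrite /W; lia.
have cop := bmod_coprime W3 ZE nW.
have eu i : i < K -> e i <= u.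
  by move=> /(leq_sum_ord e) le; rewrite /u -addnA addnCA (leq_trans le) ?leq_addr.
have wu k i : k <= e 0 -> i < K -> w k i <= u.
  move=> kn /(leq_sum_ord (w k)) le; rewrite /u (leq_trans le) //.
  have := @leq_sum_ord (e 0).+1 (fun k => \sum_(i < K) w k i) k kn.
  by move/leq_trans; apply; exact: leq_addl.
(* By Chinese remainders, one number a i carries the i-th witnesses for all k <= e 0. *)
have [a ha] : exists a : nat -> nat, forall i, i < K ->
    forall k, k < (e 0).+1 -> a i = w k i %[mod bmod Z k].
  apply: (@finite_choice _ 0 K (fun i x => forall k, k < (e 0).+1 -> x = w k i %[mod bmod Z k])).
  by move=> i iK; exact: (chinese_family (fun k => w k i) cop).
exists u, W, Z, a; rewrite /bounded_forall_witness /= -(bmod_prod W3 ZE nW).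
split; first by [].
split; first by move=> i; rewrite mem_iota; exact: eu.
do 2![split; first by []].
split=> [i|l]; rewrite mem_iota => /= il; [rewrite bin_ffact; apply: prod_coprime_dvd => //|
  apply: prod_coprime_eqmod => //] => k kn.
  by apply: (@dvd_ffact_of_eqmod _ _ (w k i)); [exact: wu | exact: ha].
have [b1 b2] := psum_bound il.
have EZ i : i < K -> join (scons Z e) a i = join (scons k e) (w k) i %[mod bmod Z k].
  move=> iK; have := leq_ltn_trans (half_le i) iK; rewrite /join.
  case: ifP => _ hi; first exact: ha.
  by case: (i./2) => //=; apply: (bmod_eqmod ZE); exact: leq_trans kn nW.
rewrite (peval_eqmod (e' := join (scons k e) (w k))) => [|i ib]; last exact: EZ (leq_trans ib _).
rewrite [RHS](peval_eqmod (e' := join (scons k e) (w k))) => [|i ib]; last exact: EZ (leq_trans ib _).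
by move/all_psatP: (sw k kn) => ->.
Qed.

End BoundedForall.

Ltac ndef_tac ::= repeat first
  [ assumption | progress cbv beta
  | lazymatch goal with
    | |- cfun ndef (fun e => @?f e ^ @?g e) => refine (@nfun_exp f g _ _)
    | |- cfun ndef (fun e => 'C(@?f e, @?g e)) => refine (@nfun_bin f g _ _)
    | |- cfun ndef (fun e => (@?f e)`!) => refine (@nfun_fact f _)
    end
  | arith_step ndef_arith ].

Lemma ec_ren_eq (D : Type) C (HC : @env_class D C) r P (T : (nat -> D) -> nat -> D) :
  (forall e i, T e i = e (r i)) -> C P -> C (fun e => P (T e)).
Proof.
move=> Tr CP; apply: (ec_ext HC _ (ec_ren HC r CP)) => e.
by rewrite (functional_extensionality _ _ (Tr e)).
Qed.

Lemma ndef_bounded_forall P : dio P -> ndef (fun e => forall k, k <= e 0 -> P (scons k e)).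
Proof.
move=> [s sP].
have ext e : (exists u W Z a, bounded_forall_witness s e u W Z a) <->
    (forall k, k <= e 0 -> P (scons k e)).
  split=> [[u [W [Z [a wit]]]] k ke|Pe].
    by apply/sP; exact: bounded_forall_sound wit k ke.
  by apply: bounded_forall_complete => k ke; apply/sP/Pe.
apply: (ec_ext ndef_class ext); do 3 apply: (ec_ex ndef_class).
have join_lt K (e a b : nat -> nat) i :
    (forall i, i < K -> a i = b i) -> i < K -> join e a i = join e b i.
  move=> ab iK; rewrite /join; case: ifP => // _; apply: ab.
  exact: leq_ltn_trans (half_le i) iK.
(* Only the first [pbound psum] entries of a occur, and they are quantified as separate
   variables. *)
apply: (@ec_exs _ _ ndef_class (pbound (psum s))) => [a b e ab|].
  move=> [h1 [h2 [h3 [h4 [h5 h6]]]]]; do 4 split=> //; split=> [i iK|k ks].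
    by rewrite -ab ?h5 //; move: iK; rewrite mem_iota.
  have k_lt : k < size s by move: ks; rewrite mem_iota.
  have [b1 b2] := psum_bound k_lt; have := h6 k ks.
  rewrite (peval_local (e' := join (scons (e 0) (fun i => e i.+3)) b)) => [|i ib]; last first.
    by apply: join_lt ab _; exact: leq_trans ib b1.
  rewrite [X in _ = X %[mod _] -> _](peval_local (e' := join (scons (e 0) (fun i => e i.+3)) b)) => [//|i ib].
  by apply: join_lt ab _; exact: leq_trans ib b2.
set K := pbound _; rewrite /bounded_forall_witness.
have cP (F : (nat -> nat) -> nat) p : cfun ndef F -> cfun ndef (fun e => peval (fun _ => F e) p).
  by move=> hF; apply: (cfun_peval ndef_arith (F := fun _ => F)).
have cJ p : cfun ndef (fun e => peval (join (scons (e (K + 0)) (fun i => e (K + i.+3))) (fun i => e i)) p).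
  apply: (cfun_peval ndef_arith
    (F := fun i e => join (scons (e (K + 0)) (fun i => e (K + i.+3))) (fun i => e i) i)).
  by move=> i; rewrite /join; case: (odd i); [|case: (i./2) => [|j] /=]; exact: (cfunV ndef_arith).
have cV := cfunV ndef_arith.
apply: (ec_and ndef_class); first by ndef_tac.
apply: (ec_and ndef_class).
  by apply: (ec_all ndef_class) ndef_true _ => i _; ndef_tac.
apply: (ec_and ndef_class).
  apply: (crel_eq ndef_arith); first by ndef_tac.
  apply: (cfunD ndef_arith); last by ndef_tac.
  by apply: (cfunD ndef_arith); [ndef_tac | apply: cP; ndef_tac].
apply: (ec_and ndef_class); first by ndef_tac.
apply: (ec_and ndef_class).
  by apply: (ec_all ndef_class) ndef_true _ => i _; ndef_tac.
apply: (ec_all ndef_class) ndef_true _ => k _.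
by apply: (crel_eqmod ndef_arith); [exact: cJ | exact: cJ | ndef_tac].
Qed.

(* The bound of the universal quantifier is also the code of all the outer
   existential variables. *)
Definition cdef (P : (nat -> nat) -> Prop) : Prop :=
  exists D, dio D /\ forall v, P v <-> exists Y, forall k, k <= Y -> D (scons k (scons Y v)).

Lemma cdef_ndef P : cdef P -> ndef P.
Proof.
move=> [D [dD PD]].
have ext v : (exists Y, forall k, k <= Y -> D (scons k (scons Y v))) <-> P v by rewrite PD.
apply: (ec_ext ndef_class ext); apply: (ec_ex ndef_class).
apply: (ec_ext ndef_class _ (ndef_bounded_forall dD)) => e.
by have -> : scons (e 0) (fun i => e i.+1) = e by apply: functional_extensionality => -[].
Qed.

Lemma dio_cdef P : dio P -> cdef P.
Proof.
move=> dP; exists (fun e => P (fun i => e i.+2)); split.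
  exact: (ec_ren dio_class (fun i => i.+2) dP).
by move=> v; split=> [Pv|[Y /(_ 0)]]; [exists 0 | apply].
Qed.

(** * Pairing and the closure properties of [cdef] *)

(** Cantor's pairing without the halving: (x + y)^2 <= [npair x y] < (x + y + 1)^2 determines x +
    y. *)
Definition npair (x y : nat) : nat := (x + y) * (x + y) + x.

Lemma npair_inj x y x' y' : npair x y = npair x' y' -> x = x' /\ y = y'.
Proof.
rewrite /npair => e; have exy : x + y = x' + y'.
  by case: (ltngtP (x + y) (x' + y')) => // lt; nia.
by rewrite exy in e; lia.
Qed.

Lemma leq_npair x y : x <= npair x y /\ y <= npair x y.
Proof.
have : x + y <= (x + y) * (x + y) by case: (x + y) => // n; exact: leq_pmulr.
by rewrite /npair; lia.
Qed.

Lemma modn_uniq k k' Y : k <= Y -> k' <= Y -> k = k' %[mod Y.+1] -> k = k'.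
Proof. by move=> kY kY'; rewrite !modn_small. Qed.

(** The two bounds are packed into [npair Y1 Y2], which is at least both; as k runs up to it, its
    remainders modulo Y1 + 1 and Y2 + 1 take all the required values. *)
Lemma cdef_and P Q : cdef P -> cdef Q -> cdef (fun e => P e /\ Q e).
Proof.
move=> [D1 [dD1 PD]] [D2 [dD2 QD]].
exists (fun e => exists Y1 Y2 k1 k2, npair Y1 Y2 = e 1 /\
  (k1 <= Y1 /\ k1 = e 0 %[mod Y1.+1] /\ D1 (scons k1 (scons Y1 (fun i => e i.+2)))) /\
  (k2 <= Y2 /\ k2 = e 0 %[mod Y2.+1] /\ D2 (scons k2 (scons Y2 (fun i => e i.+2))))).
split.
  rewrite /npair; arith_tac dio_arith.
    apply: (ec_ren_eq dio_class
      (r := fun i => match i with 0 => 1 | 1 => 3 | j.+2 => j + 6 end) _ dD1).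
    by move=> e [|[|i]] //=; rewrite addnC.
  apply: (ec_ren_eq dio_class
    (r := fun i => match i with 0 => 0 | 1 => 2 | j.+2 => j + 6 end) _ dD2).
  by move=> e [|[|i]] //=; rewrite addnC.
move=> v; rewrite PD QD; split=> [[[Y1 h1] [Y2 h2]]|[Z hZ]].
  exists (npair Y1 Y2) => k kZ; exists Y1, Y2, (k %% Y1.+1), (k %% Y2.+1).
  have m1 : k %% Y1.+1 <= Y1 by rewrite -ltnS ltn_pmod.
  have m2 : k %% Y2.+1 <= Y2 by rewrite -ltnS ltn_pmod.
  by split=> //; split; (split=> //; split; first exact: modn_mod); [exact: h1 | exact: h2].
have [Y1 [Y2 [_ [_ [/= eZ _]]]]] := hZ 0 isT.
have [le1 le2] := leq_npair Y1 Y2; rewrite eZ in le1 le2.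
split; [exists Y1 | exists Y2] => k kY.
  have [Y1' [Y2' [k1 [k2 [/= eZ' [[k1Y [k1k D1k]] _]]]]]] := hZ k (leq_trans kY le1).
  have [e1 _] := npair_inj (etrans eZ (esym eZ')); rewrite -e1 in k1Y k1k D1k.
  by rewrite (modn_uniq k1Y kY k1k) in D1k.
have [Y1' [Y2' [k1 [k2 [/= eZ' [_ [k2Y [k2k D2k]]]]]]]] := hZ k (leq_trans kY le2).
have [_ e2] := npair_inj (etrans eZ (esym eZ')); rewrite -e2 in k2Y k2k D2k.
by rewrite (modn_uniq k2Y kY k2k) in D2k.
Qed.

(** The unknown x is packed with the old bound Y, and injectivity makes all k agree on both.
    Reducing k modulo Y + 1 makes the larger bound harmless. *)
Lemma cdef_ex (P : nat -> (nat -> nat) -> Prop) :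
  cdef (fun e => P (e 0) (fun i => e i.+1)) -> cdef (fun e => exists x, P x e).
Proof.
move=> [D [dD PD]].
exists (fun e => exists x Y k, npair x Y = e 1 /\ k <= Y /\ k = e 0 %[mod Y.+1] /\
  D (scons k (scons Y (scons x (fun i => e i.+2))))).
split.
  rewrite /npair; arith_tac dio_arith.
  apply: (ec_ren_eq dio_class (r := fun i => if i is j.+3 then j + 5 else i) _ dD).
  by move=> e [|[|[|i]]] //=; rewrite addnC.
move=> v; split=> [[x /(PD (scons x v))[Y h]]|[Z hZ]].
  exists (npair x Y) => k kZ; exists x, Y, (k %% Y.+1).
  have m : k %% Y.+1 <= Y by rewrite -ltnS ltn_pmod.
  by split=> //; split=> //; split; [exact: modn_mod | exact: h].
have [x [Y [_ [/= eZ _]]]] := hZ 0 isT; exists x; apply/(PD (scons x v)); exists Y => k kY.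
have [_ leY] := leq_npair x Y; rewrite eZ in leY.
have [x' [Y' [k' [/= eZ' [k'Y [k'k Dk]]]]]] := hZ k (leq_trans kY leY).
have [e1 e2] := npair_inj (etrans eZ (esym eZ')); rewrite -e1 -e2 in k'Y k'k Dk.
by rewrite (modn_uniq k'Y kY k'k) in Dk.
Qed.

Lemma cdef_class : env_class cdef.
Proof.
split=> [P Q PQ [D [dD PD]]|r P [D [dD PD]]||].
- by exists D; split=> // v; rewrite -PQ.
- exists (fun e => D (scons (e 0) (scons (e 1) (fun i => e (r i).+2)))); split.
    by apply: (ec_ren_eq dio_class (r := fun i => if i is j.+2 then (r j).+2 else i) _ dD) => e [|[|i]].
  by move=> v; rewrite PD.
- exact: cdef_and.
exact: cdef_ex.
Qed.

Lemma cdef_arith : arith_class cdef.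
Proof.
have [_ a1 a2 a3 a4] := dio_arith.
by split=> [||c||]; [exact: cdef_class | | | |]; exact: dio_cdef.
Qed.

(** If e i < e j, the inequality e j <= e i + x * e j excludes x = 0 and leaves D; otherwise x = 0
    satisfies it. *)
Lemma cdef_lt_imp i j P : cdef P -> cdef (fun e => e i < e j -> P e).
Proof.
move=> [D [dD PD]].
exists (fun e => exists x, (x = 0 \/ D (scons (e 0) (scons (e 1) (fun l => e l.+2)))) /\
  e j.+2 <= e i.+2 + x * e j.+2); split.
  apply: (ec_ex dio_class); apply: (ec_and dio_class); last by arith_tac dio_arith.
  apply: (ec_ext dio_class _ (dio_zero_or dD)) => e.
  suff -> : scons (e 1) (scons (e 2) (fun l => e l.+3)) = (fun i => e i.+1) by [].
  by apply: functional_extensionality => -[|[|l]].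
move=> v; split=> [Pv|[Y hY] ltij].
  case: (ltnP (v i) (v j)) => [/Pv /PD[Y h]|ji].
    by exists Y => k /h Dk; exists 1; split; [right | rewrite mul1n leq_addl].
  by exists 0 => k _; exists 0; split; [left | rewrite /= mul0n addn0].
apply/PD; exists Y => k kY; have [x [/= [-> | Dk] le]] := hY k kY; last exact: Dk.
by rewrite mul0n addn0 leqNgt ltij in le.
Qed.

(** * Sequence coding and bounded quantifiers inside [cdef] *)

(** A variant of Goedel's beta function with moduli m = (Z + 1)/(i + 1) - 1, the division being
    written as a product; the remainders of S are the entries. *)
Definition beta (S Z i y : nat) : Prop :=
  exists m, i.+1 * m.+1 = Z.+1 /\ y < m /\ S = y %[mod m].

Lemma beta_fun S Z i y y' : beta S Z i y -> beta S Z i y' -> y = y'.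
Proof.
move=> [m [em [ym Sy]]] [m' [em' [ym' Sy']]].
have /eqP := etrans em (esym em'); rewrite eqn_pmul2l // eqSS => /eqP e.
by rewrite -e Sy in ym' Sy'; move: Sy'; rewrite !modn_small.
Qed.

Lemma beta_exists (f : nat -> nat) n : exists S Z, forall i, i <= n -> beta S Z i (f i).
Proof.
(* Each modulus is at least W - 1, which has to exceed the values f i. *)
pose W := n + \sum_(i < n.+1) f i + 3.
have [Z ZE] : exists Z, Z.+1 = W`! * W`!.
  by exists (W`! * W`!).-1; rewrite prednK // muln_gt0 fact_gt0.
have W3 : 3 <= W by rewrite leq_addl.
have nW : n < W by rewrite /W; move: (\sum_(_ < _) _) => x; clear; lia.
have [S hS] := chinese_family f (bmod_coprime W3 ZE nW).
exists S, Z => i ni; have iW := leq_ltn_trans ni nW.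
exists (bmod Z i); split; first exact: (bmodK ZE iW).
split; last exact: hS.
have /leq_trans : (f i).+2 <= W.
  have := @leq_sum_ord n.+1 f i ni; rewrite /W; move: (\sum_(_ < _) _) => x; lia.
have WW : W <= W`! by rewrite dvdn_leq ?fact_gt0 // dvdn_fact // (leq_trans _ W3) /=.
move/(_ _ WW) => h; rewrite -ltnS (bmodS ZE iW) (leq_trans h) // leq_pmulr //.
exact: fact_div_gt0.
Qed.

Lemma beta_def C (AC : arith_class C) F G H K :
  cfun C F -> cfun C G -> cfun C H -> cfun C K ->
  C (fun e => beta (F e) (G e) (H e) (K e)).
Proof.
move=> cF cG cH cK; have HC := ac_env AC.
have sh L : cfun C L -> cfun C (fun e => L (fun i => e i.+1)) by exact: (cfun_ren HC succn).
apply: (ec_ex HC); apply: (ec_and HC).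
  apply: (crel_eq AC); last by apply: (cfunS AC); exact: sh.
  by apply: (cfunM AC); [apply: (cfunS AC); exact: sh | arith_tac AC].
apply: (ec_and HC); first by apply: (crel_le AC); [apply: (cfunS AC); exact: sh | arith_tac AC].
by apply: (crel_eqmod AC); [exact: sh | exact: sh | arith_tac AC].
Qed.

Lemma mixed_radix n B i j : i <= n -> j <= B -> i + n.+1 * j < n.+1 * B.+1.
Proof. by move=> ni jB; rewrite mulnS -addSn leq_add // leq_mul2l jB orbT. Qed.

Lemma mixed_radix_inj n B i j i' j' : i <= n -> j <= B -> i' <= n -> j' <= B ->
  i + n.+1 * j = i' + n.+1 * j' %[mod n.+1 * B.+1] -> i = i' /\ j = j'.
Proof.
move=> ni jB ni' jB'; rewrite !modn_small ?mixed_radix // => e.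
have dm x y : x <= n -> ((x + n.+1 * y) %% n.+1 = x) * ((x + n.+1 * y) %/ n.+1 = y).
  by move=> xn; rewrite addnC mulnC modnMDl modn_small // divnMDl // divn_small // addn0.
by split; [rewrite -(dm i j ni).1 e (dm _ _ ni').1 | rewrite -(dm i j ni).2 e (dm _ _ ni').2].
Qed.

(* The family of witnesses of the inner existential is coded by [S, T], and the
   two universal quantifiers are merged through [k = i + (n + 1) j]. *)
Lemma cdef_forall_le n (P : nat -> (nat -> nat) -> Prop) :
  cdef (fun e => P (e 0) (fun l => e l.+1)) -> cdef (fun e => forall i, i <= e n -> P i e).
Proof.
move=> [D [dD PD]].
(* B bounds the inner bounds Y, and [pad] makes e 1 large enough for k to reach every pair (i, j)
   with j <= B. *)
exists (fun e => exists S T B pad i j Y j', npair (npair S T) (npair B pad) = e 1 /\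
  (e n.+2).+1 * B.+1 <= pad /\ i <= e n.+2 /\ j <= B /\
  e 0 = i + (e n.+2).+1 * j %[mod (e n.+2).+1 * B.+1] /\ Y <= B /\ beta S T i Y /\
  j' <= Y /\ j' = j %[mod Y.+1] /\ D (scons j' (scons Y (scons i (fun l => e l.+2))))).
split.
  rewrite /npair; do 8 apply: (ec_ex dio_class).
  do 6 (apply: (ec_and dio_class); first by arith_tac dio_arith).
  apply: (ec_and dio_class); first by apply: (beta_def dio_arith); arith_tac dio_arith.
  do 2 (apply: (ec_and dio_class); first by arith_tac dio_arith).
  apply: (ec_ren_eq dio_class
    (r := fun i => match i with 0 => 0 | 1 => 1 | 2 => 3 | i.+3 => i + 10 end) _ dD).
  by move=> e [|[|[|i]]] //=; rewrite addnC.
move=> v; split=> [Pv|[Z hZ]].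
  have [f hf] := @finite_choice _ 0 (v n).+1
    (fun i Y => forall k, k <= Y -> D (scons k (scons Y (scons i v))))
    (fun i ni => (PD (scons i v)).1 (Pv i ni)).
  have [S [T hST]] := beta_exists f (v n).
  pose B := \sum_(i < (v n).+1) f i; pose pad := (v n).+1 * B.+1.
  exists (npair (npair S T) (npair B pad)) => k _.
  pose i := k %% (v n).+1; pose j := k %/ (v n).+1 %% B.+1.
  have ni : i <= v n by rewrite -ltnS ltn_pmod.
  have fB : f i <= B by exact: leq_sum_ord.
  have jf : j %% (f i).+1 <= f i by rewrite -ltnS ltn_pmod.
  exists S, T, B, pad, i, j, (f i), (j %% (f i).+1).
  split; first by [].
  split; first by [].
  split; first by [].
  split; first by rewrite -ltnS ltn_pmod.
  split.
    rewrite /= {1}(divn_eq k (v n).+1) -/i {1}(divn_eq (k %/ _) B.+1) -/j.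
    by rewrite mulnDl -mulnA [B.+1 * _]mulnC -addnA modnMDl addnC [j * _]mulnC.
  split; first by [].
  split; first exact: hST.
  split; first by [].
  split; first exact: modn_mod.
  exact: hf.
have [S [T [B [pad [_ [_ [_ [_ [/= eZ [lepad _]]]]]]]]]] := hZ 0 isT.
have key i j : i <= v n -> j <= B -> exists Y j', Y <= B /\ beta S T i Y /\
    j' <= Y /\ j' = j %[mod Y.+1] /\ D (scons j' (scons Y (scons i v))).
  move=> ni jB; have kZ : i + (v n).+1 * j <= Z.
    rewrite (leq_trans (ltnW (mixed_radix ni jB))) // (leq_trans lepad) // -eZ.
    by rewrite (leq_trans (leq_npair B pad).2) // (leq_npair _ _).2.
  have [S' [T' [B' [pad' [i' [j0 [Y [j' hk]]]]]]]] := hZ _ kZ.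
  move: hk => /= [eZ' [lepad' [ni' [jB' [ek [YB [hb [j'Y [ej Dj]]]]]]]]].
  have [e1 e2] := npair_inj (etrans eZ (esym eZ')).
  have [eS eT] := npair_inj e1; have [eB _] := npair_inj e2.
  rewrite -eS -eT -eB in YB hb jB' ek.
  have [ei e0] := mixed_radix_inj ni jB ni' jB' ek.
  by exists Y, j'; rewrite ei e0.
move=> i ni; apply/(PD (scons i v)).
(* Y is read off at j = 0; the code S, T guarantees the same Y for every j. *)
have [Y [_ [YB [hY _]]]] := key i 0 ni isT.
exists Y => j jY; have [Y' [j' [_ [hY' [j'Y [ej Dj]]]]]] := key i j ni (leq_trans jY YB).
rewrite (beta_fun hY' hY) in j'Y ej Dj.
by rewrite (modn_uniq j'Y jY ej) in Dj.
Qed.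

Lemma cdef_forall_lt n (P : nat -> (nat -> nat) -> Prop) :
  cdef (fun e => P (e 0) (fun l => e l.+1)) -> cdef (fun e => forall i, i < e n -> P i e).
Proof.
move=> CP; have := @cdef_forall_le n (fun i e => i < e n -> P i e) (cdef_lt_imp 0 n.+1 CP).
apply: (ec_ext cdef_class) => e; split=> h i ltin; first exact: h (ltnW ltin) ltin.
exact: h.
Qed.

(** * Graphs of recursive functions *)

Definition tup k (e : nat -> nat) : k.-tuple nat := [tuple e i | i < k].

Lemma tup_scons k x e : tup k.+1 (scons x e) = [tuple of x :: tup k e].
Proof.
apply: eq_from_tnth => i; rewrite tnth_mktuple.
by case: (unliftP ord0 i) => [j|] ->; rewrite ?tnthS ?tnth_mktuple ?tnth0.
Qed.

Lemma behead_tup k e : behead_tuple (tup k.+1 e) = tup k (fun i => e i.+1).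
Proof.
by apply: eq_from_tnth => i; rewrite tnth_behead !tnth_mktuple /= inordK // ltnS.
Qed.

Lemma thead_tup k e : thead (tup k.+1 e) = e 0.
Proof. by rewrite /thead tnth_mktuple. Qed.

Lemma eq_tup k e e' : (forall i, i < k -> e i = e' i) -> tup k e = tup k e'.
Proof. by move=> ee; apply: eq_from_tnth => i; rewrite !tnth_mktuple ee. Qed.

Lemma tup_nth k (w : k.-tuple nat) : tup k (nth 0 w) = w.
Proof. by apply: eq_from_tnth => i; rewrite tnth_mktuple (tnth_nth 0). Qed.

(** The course of values, a function, is replaced by its code S, T read through [beta]: a
    second-order witness becomes two numbers. *)
Lemma recfun_graph_prec k (f : recfun k) (g : recfun k.+2) (e : nat -> nat) :
  recfun_graph (RPrec f g) (tup k.+1 (fun i => e i.+1)) (e 0) <->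
  exists S T, (exists y, beta S T 0 y /\ recfun_graph f (tup k (fun i => e i.+2)) y) /\
    (forall i, i < e 1 -> exists y y', beta S T i y /\ beta S T i.+1 y' /\
       recfun_graph g (tup k.+2 (scons i (scons y (fun j => e j.+2)))) y') /\
    beta S T (e 1) (e 0).
Proof.
set v := tup _ _; have tv : thead v = e 1 by exact: thead_tup.
have fv : behead_tuple v = tup k (fun i => e i.+2) by exact: behead_tup.
have gv i y : [tuple of i :: y :: behead_tuple v] = tup k.+2 (scons i (scons y (fun j => e j.+2))).
  by apply: val_inj; rewrite !tup_scons /= -[behead _]/(val (behead_tuple v)) fv.
split=> [[s [sf sg es]]|[S [T [[y0 [b0 hf]] [hg hr]]]]].
  rewrite tv in sg es; rewrite fv in sf.
  have [S [T hST]] := beta_exists s (e 1); exists S, T.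
  split; first by exists (s 0); split; [exact: hST|].
  split; last by rewrite es; exact: hST.
  move=> i ie; exists (s i), (s i.+1); split; first exact: hST (ltnW ie).
  by split; [exact: hST | rewrite -gv; exact: sg].
(* Entries below e 1 exist by the recursion clause, the one at e 1 by the final clause. *)
have bex i : i < (e 1).+1 -> exists y, beta S T i y.
  rewrite ltnS leq_eqVlt => /predU1P[->|/hg[y [_ [hy _]]]]; first by exists (e 0).
  by exists y.
have [s hs] := finite_choice 0 bex; exists s; split.
- by rewrite fv (beta_fun (hs 0 isT) b0).
- rewrite tv => i ie; have [y [y' [hy [hy' g']]]] := hg i ie.
  by rewrite gv (beta_fun (hs i (ltnW ie)) hy) (beta_fun (hs i.+1 ie) hy').
by rewrite tv; exact: beta_fun hr (hs _ (ltnSn _)).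
Qed.

Lemma recfun_graph_comp k m (f : recfun m) (gs : 'I_m -> recfun k) v r :
  recfun_graph (RComp f gs) v r <->
  exists a : nat -> nat, (forall i, i \in enum 'I_m -> recfun_graph (gs i) v (a i)) /\
    recfun_graph f (tup m a) r.
Proof.
split=> [[w [hw hf]]|[a [ha hf]]].
  exists (nth 0 w); rewrite tup_nth; split=> // i _; rewrite -tnth_nth; exact: hw.
by exists (tup m a); split=> // i; rewrite tnth_mktuple; apply: ha; rewrite mem_enum.
Qed.

(** Induction on f; the bounded quantifiers of recursion and minimization are absorbed by
    [cdef_forall_lt]. *)
Lemma cdef_recfun_graph k (f : recfun k) :
  cdef (fun e => recfun_graph f (tup k (fun i => e i.+1)) (e 0)).
Proof.
have HC := cdef_class; have AC := cdef_arith.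
elim: f => {k} [k||k i|k m f IHf gs IHg|k f IHf g IHg|k f IHf].
- have H : cdef (fun e => e 0 = 0) by arith_tac AC.
  exact: H.
- have H : cdef (fun e => e 0 = (e 1).+1) by arith_tac AC.
  by apply: (ec_ext HC _ H) => e; rewrite /= thead_tup.
- have H : cdef (fun e => e 0 = e i.+1) by arith_tac AC.
  by apply: (ec_ext HC _ H) => e; rewrite /= tnth_mktuple.
- apply: (ec_ext HC (fun e => iff_sym (recfun_graph_comp f gs _ _))).
  apply: (@ec_exs _ _ HC m) => [a b e ab [ha hf]|].
    split=> [i im|]; first by rewrite -ab //; exact: ha.
    by rewrite (eq_tup ab) in hf.
  apply: (ec_and HC).
    apply: (ec_all HC) => [|i _].
      by apply: dio_cdef; apply: (ec_ext dio_class _ (dio_sat (PVar 0) (PVar 0))).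
    exact: (ec_ren HC (fun j => if j is l.+1 then m + l.+1 else i) (IHg i)).
  apply: (ec_ext HC _ (ec_ren HC (fun j => if j is l.+1 then l else m + 0) IHf)) => e.
  by [].
- apply: (ec_ext HC (fun e => iff_sym (recfun_graph_prec f g e))).
  do 2 apply: (ec_ex HC); apply: (ec_and HC).
    apply: (ec_ex HC); apply: (ec_and HC); first by apply: (beta_def AC); arith_tac AC.
    exact: (ec_ren HC (fun j => if j is l.+1 then l.+4.+1 else 0) IHf).
  apply: (ec_and HC); last by apply: (beta_def AC); arith_tac AC.
  apply: (cdef_forall_lt 3); do 2 apply: (ec_ex HC).
  do 2 (apply: (ec_and HC); first by apply: (beta_def AC); arith_tac AC).
  apply: (ec_ren_eq HC (T := fun e => scons (e 0) (scons (e 2) (scons (e 1) (fun j => e j.+4.+3))))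
    (r := fun i => match i with 0 => 0 | 1 => 2 | 2 => 1 | j.+3 => j.+4.+3 end) _ IHg).
  by move=> e [|[|[|j]]].
(* The induction hypothesis takes the value from a variable, so 0 and y + 1 are named by a fresh
   z. *)
have H : cdef (fun e =>
    (exists z, z = 0 /\ recfun_graph f (tup k.+1 (scons (e 0) (fun j => e j.+1))) z) /\
    forall i, i < e 0 -> exists y z, z = y.+1 /\
      recfun_graph f (tup k.+1 (scons i (fun j => e j.+1))) z).
  apply: (ec_and HC).
    apply: (ec_ex HC); apply: (ec_and HC); first by arith_tac AC.
    apply: (ec_ren_eq HC (T := fun e => scons (e 0) (scons (e 1) (fun j => e j.+2)))
      (r := id) _ IHf).
    by move=> e [|[|j]].
  apply: (cdef_forall_lt 0); do 2 apply: (ec_ex HC).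
  apply: (ec_and HC); first by arith_tac AC.
  apply: (ec_ren_eq HC (T := fun e => scons (e 0) (scons (e 2) (fun j => e j.+4)))
    (r := fun i => match i with 0 => 0 | 1 => 2 | j.+2 => j.+4 end) _ IHf).
  by move=> e [|[|j]].
apply: (ec_ext HC _ H) => e; rewrite /= -tup_scons; split=> [[[_ [-> h0]] h]|[h0 h]].
  by split=> // i /h[y [_ [-> hy]]]; exists y; rewrite -tup_scons.
split; first by exists 0.
by move=> i /h[y]; rewrite -tup_scons => hy; exists y, y.+1.
Qed.

Lemma recfun_graph_fun k (f : recfun k) v r r' :
  recfun_graph f v r -> recfun_graph f v r' -> r = r'.
Proof.
elim: f v r r' => {k} [k||k i|k m f IHf gs IHg|k f IHf g IHg|k f IHf] v r r' /=.
- by move=> -> ->.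
- by move=> -> ->.
- by move=> -> ->.
- move=> [w [hw hf]] [w' [hw' hf']]; apply: IHf hf _.
  suff -> : w = w' by [].
  by apply: eq_from_tnth => i; exact: IHg (hw i) (hw' i).
- move=> [s [sf sg ->]] [s' [sf' sg' ->]].
  suff h i : i <= thead v -> s i = s' i by exact: h.
  elim: i => [|i IH] ni; first exact: IHf sf sf'.
  by have := sg i ni; have := sg' i ni; rewrite (IH (ltnW ni)) => h' h; exact: IHg h h'.
move=> [h0 h] [h0' h']; case: (ltngtP r r') => // lt.
  by have [y hy] := h' r lt; have := IHf _ _ _ h0 hy.
by have [y hy] := h r' lt; have := IHf _ _ _ h0' hy.
Qed.

(** * From group terms to coded systems, and self-reference *)

Fixpoint gbound (t : gterm) : nat :=
  match t with
  | GVar i => i.+1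
  | GConst _ => 0
  | GMul t1 t2 => gbound t1 + gbound t2
  | GInv t1 => gbound t1
  end.

(** Inversion is pushed down to the letters, reversing products on its way, because words have no
    inverse of a subword. *)
Fixpoint gword N (inverted : bool) (t : gterm) : seq (letter ZwrZ N.+1) :=
  match t with
  | GVar i => [:: if inverted then VarInv (inord i) else Var (inord i)]
  | GConst c => [:: Const (if inverted then (c^-1)%g else c)]
  | GMul t1 t2 => if inverted then gword N inverted t2 ++ gword N inverted t1
                  else gword N inverted t1 ++ gword N inverted t2
  | GInv t1 => gword N (~~ inverted) t1
  end.

Lemma word_eval_cat (G : groupType) n (g : 'I_n -> G) w1 w2 :
  word_eval g (w1 ++ w2) = (word_eval g w1 * word_eval g w2)%g.
Proof. by rewrite /word_eval big_cat. Qed.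

Lemma word_eval1 (G : groupType) n (g : 'I_n -> G) l : word_eval g [:: l] = letter_eval g l.
Proof. by rewrite /word_eval big_seq1. Qed.

Lemma word_eval_gword N (g : 'I_N.+1 -> ZwrZ) e t b :
    (forall i, i < gbound t -> e i = g (inord i)) ->
  word_eval g (gword N b t) = if b then ((geval e t)^-1)%g else geval e t.
Proof.
elim: t b => [i|c|t1 IH1 t2 IH2|t1 IH1] b /= eg.
- by rewrite word_eval1 eg //; case: b.
- by rewrite word_eval1; case: b.
- have eg1 i : i < gbound t1 -> e i = g (inord i) by move=> ti; apply: eg; rewrite ltn_addr.
  have eg2 i : i < gbound t2 -> e i = g (inord i) by move=> ti; apply: eg; rewrite ltn_addl.
  by case: b; rewrite word_eval_cat IH1 // IH2 // invgM.
by rewrite IH1 //; case: b; rewrite //= invgK.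
Qed.

Lemma all_gword N (g : 'I_N.+1 -> ZwrZ) e s :
    \sum_(t <- s) gbound t <= N.+1 -> (forall i, i < N.+1 -> e i = g (inord i)) ->
  all (fun w => word_eval g w == 1%g) [seq gword N false t | t <- s] = all (gsat e) s.
Proof.
move=> + eg; elim: s => //= t s IH; rewrite big_cons => tN.
rewrite IH; last exact: leq_trans (leq_addl _ _) tN.
rewrite (@word_eval_gword _ _ e) // => i it; apply: eg.
exact: leq_trans it (leq_trans (leq_addr _ _) tN).
Qed.

(** As an equation, this word fixes a parameter of the system: variable i becomes the number n. *)
Definition pin N (i n : nat) : seq (letter ZwrZ N.+1) := [:: VarInv (inord i); Const (num n)].

Lemma word_eval_pin N (g : 'I_N.+1 -> ZwrZ) i n :
  word_eval g (pin N i n) == 1%g = (g (inord i) == num n).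
Proof.
rewrite /pin -[[:: _; _]]/([:: VarInv (inord i)] ++ [:: Const (num n)]).
rewrite word_eval_cat !word_eval1 /=; apply/eqP/eqP => [e|->]; last exact: mulVg.
by rewrite -[num n](mulVKg (g (inord i))) e mulg1.
Qed.

(** [CodeSeq.code] of a list with head x and a tail of code y, written in operations that [ndef_tac]
    recognizes. *)
Definition cons_code (x y : nat) : nat := 2 ^ x * (y + y).+1.

(** In the constant letter, the head 0 codes the zero polynomial and n + n codes the integer n. *)
Definition pin_code (i n : nat) : nat :=
  cons_code (cons_code 1 (cons_code i 0))
    (cons_code (cons_code 2 (cons_code (cons_code 0 (cons_code (n + n) 0)) 0)) 0).

Lemma code_pin N i n : i <= N -> code_word code_ZwrZ (pin N i n) = pin_code i n.
Proof.
move=> iN; rewrite /code_word /= /code_ZwrZ /code_laurent /= msupp0.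
rewrite inordK ?ltnS // -!addnn.
have -> : sort <=%R (fset0 : {fset int}) = [::] by [].
by [].
Qed.

(** Here c codes the equations other than the two pins, so its occurrence as the constant of the
    second pin is not circular, and the whole code is an explicit function of n and c. *)
Definition system_code (n c : nat) : nat :=
  cons_code n (cons_code (cons_code (pin_code 0 n) (cons_code (pin_code 2 c) c)) 0).

Lemma ndef_self_code (d : recfun 1) : ndef (fun e =>
  recfun_graph d [tuple system_code (e 0) (e 1)] 0).
Proof.
pose R x := recfun_graph d [tuple x] 0.
apply: (@cfun_rel1 _ ndef_class R (fun e => system_code (e 0) (e 1))); last first.
  by rewrite /system_code /pin_code /cons_code; ndef_tac.
have H : cdef (fun e => exists z, z = 0 /\ recfun_graph d (tup 1 (fun i => e i)) z).
  apply: (ec_ex cdef_class); apply: (ec_and cdef_class); first by arith_tac cdef_arith.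
  exact: cdef_recfun_graph.
apply: (ec_ext ndef_class _ (cdef_ndef H)) => e; rewrite /R.
have -> : tup 1 (fun i => e i) = [tuple e 0].
  by apply: eq_from_tnth => i; rewrite tnth_mktuple (ord1 i).
by split=> [[_ [-> h]]|h]; [|exists 0].
Qed.

Theorem theorem1p3 :
  ~ decidable_problem (code_system code_ZwrZ)
      (fun S : system ZwrZ => solvable S).
Proof.
move=> [d hd]; have [Q [gQ PQ]] := ndef_self_code d.
(* All variables from 1 on are identified, which leaves two parameters; [join] stores them at
   positions 0 and 2. *)
have [s sQ] := ec_ren gdef_class (minn 1) gQ.
(* The sum bounds the indices in use, and the 2 ensures that position 2 exists. *)
pose N := 2 + \sum_(t <- s) gbound t.
pose ws := [seq gword N false t | t <- s].
pose c := CodeSeq.code [seq code_word code_ZwrZ w | w <- ws].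
pose T := @System ZwrZ N.+1 [:: pin N 0 N.+1, pin N 2 c & ws].
have codeT : code_system code_ZwrZ T = system_code N.+1 c.
  by rewrite /code_system /= !code_pin // -!addnn.
pose v i := if i is 0 then N.+1 else c.
have PT : recfun_graph d [tuple system_code N.+1 c] 0 <-> Q (fun i => num (v i)) := PQ v.
have sN : \sum_(t <- s) gbound t <= N.+1 by rewrite leqW // leq_addl.
suff solT : solvable T <-> recfun_graph d [tuple code_system code_ZwrZ T] 0.
  have nsol : ~ solvable T.
    move=> sol; have := recfun_graph_fun ((hd T).1 sol) (solT.1 sol); by [].
  exact/nsol/solT/(hd T).2.
rewrite codeT PT; split=> [[g]|Qv].
  rewrite /= !word_eval_pin => /and3P[/eqP g0 /eqP g2 gs].
  pose e i := g (inord i.*2); pose w i := g (inord i.*2.+1).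
  have je i : join e w i = g (inord i).
    rewrite /join /e /w; case: ifP => oi; rewrite -{2}[i]odd_double_half oi //.
  have <- : (fun i => e (minn 1 i)) = (fun i => num (v i)).
    by apply: functional_extensionality => -[|[|i]].
  by apply/sQ; exists w; rewrite -(all_gword sN (fun i _ => je i)).
have [w hw] : exists w, all (gsat (join (fun i => num (v i)) w)) s.
  apply/sQ; rewrite (_ : (fun i => _) = (fun i => num (v i))) //.
  by apply: functional_extensionality => -[|[|i]].
exists (fun i : 'I_N.+1 => join (fun i => num (v i)) w i); rewrite /= !word_eval_pin !inordK //.
rewrite (all_gword (e := join (fun i => num (v i)) w) sN) => [|i iN]; last by rewrite inordK.
by rewrite hw /join /= !eqxx.
Qed.
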